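(* Let $k\ge1$ be an integer. For every integer $g\ge 1$ the intersection matrix $M_{2k}=(\langle C,D\rangle)_{C,D\in\mathcal D^\ell(2k)}$ is positive semi-definite (so that it defines a, possibly degenerate, metric on $\mathbb Q\mathcal D^\ell(2k)$ depending on $g$). Furthermore, there exist subspaces $E_\lambda\subset\mathbb Q\mathcal D^\ell(2k)$, indexed by the Young diagrams $\lambda$ with $|\lambda|=k$ and defined independently of $g$, such that for every $g$ there is a direct sum decomposition $$\mathbb Q\mathcal D^\ell(2k)=\bigoplus_{|\lambda|=k}E_\lambda$$ that is orthogonal with respect to $\langle\ ,\ \rangle$, and $\mathcal M$ acts on $E_\lambda$ as multiplication by $$\mu_\lambda=\prod_{b:\ \text{box of }\lambda}(2g-2s_b+t_b),$$ where $s_b$ denotes the number of columns of $\lambda$ to the left of the column containing $b$ and $t_b$ denotes the number of rows of $\lambda$ above the row containing $b$. Moreover each $E_\lambda$ is an irreducible $\mathfrak S_{2k}$-submodule and $$E_\lambda\cong(2\lambda)_{\mathfrak S_{2k}},$$ so that this is also the irreducible decomposition of the $\mathfrak S_{2k}$-module $\mathbb Q\mathcal D^\ell(2k)$.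
   Context: A linear chord diagram with $2k$ vertices is a partition $C=\{\{i_1,j_1\},\dots,\{i_k,j_k\}\}$ of $\{1,\dots,2k\}$ into $k$ pairs, regarded as a graph with vertices $1,\dots,2k$ and $k$ edges (chords). $\mathcal D^\ell(2k)$ is the set of all of them (it has $(2k-1)!!$ elements) and $\mathbb Q\mathcal D^\ell(2k)$ is the $\mathbb Q$-vector space with basis $\mathcal D^\ell(2k)$. The symmetric group $\mathfrak S_{2k}$ acts naturally on $\mathcal D^\ell(2k)$, hence linearly on $\mathbb Q\mathcal D^\ell(2k)$. For $C,C'\in\mathcal D^\ell(2k)$ put $\langle C,C'\rangle=(-1)^{k-r}(2g)^r$, where $r$ is the number of connected components of the graph $C\cup C'$ (on the vertex set $\{1,\dots,2k\}$, with the interiors of the $2k$ edges considered mutually disjoint), and extend bilinearly. The linear map $\mathcal M:\mathbb Q\mathcal D^\ell(2k)\to\mathbb Q\mathcal D^\ell(2k)$ is $\mathcal M(C)=\sum_{D\in\mathcal D^\ell(2k)}\langle C,D\rangle D$, represented by the matrix $M_{2k}$. For a Young diagram $\lambda=[\lambda_1\cdots\lambda_h]$ (rows of lengths $\lambda_1\ge\cdots\ge\lambda_h\ge1$, $|\lambda|=\sum\lambda_i$), $2\lambda=[2\lambda_1\,2\lambda_2\cdots2\lambda_h]$. For $|\nu|=d$, $\nu_{\mathfrak S_d}$ is the irreducible representation over $\mathbb Q$ of $\mathfrak S_d$ corresponding to $\nu$ (convention: $[d]_{\mathfrak S_d}$ is trivial). *)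

(* Defs.v *)
From HB Require Import structures.
From mathcomp Require Import all_boot all_order all_fingroup all_algebra.
From mathcomp Require Import mxrepresentation.

Set Implicit Arguments.
Unset Strict Implicit.
Unset Printing Implicit Defensive.

Import Order.TTheory GRing.Theory Num.Theory.
Local Open Scope ring_scope.

(* The vertices 1, ..., 2k are represented by 'I_k.*2 = {0, ..., 2k-1}. *)
Definition is_chord_diagram (k : nat) (P : {set {set 'I_k.*2}}) : bool :=
  partition P [set: 'I_k.*2] && [forall B in P, #|B| == 2].

Record chord_diagram (k : nat) := ChordDiagram {
  chords :> {set {set 'I_k.*2}};
  _ : is_chord_diagram chords
}.
HB.instance Definition _ k := [isSub for @chords k].
HB.instance Definition _ k := [Finite of chord_diagram k by <:].

Lemma chord_diagram_act_subproof (k : nat) (C : chord_diagram k)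
    (s : 'S_(k.*2)) :
  is_chord_diagram ((fun B : {set 'I_k.*2} => s @: B) @: chords C).
Proof.
have /andP[/and3P[/eqP covC trivC C0] /forall_inP C2] := valP C.
have injs : injective (fun B : {set 'I_k.*2} => s @: B).
  exact/imset_inj/perm_inj.
apply/andP; split; last first.
  apply/forall_inP => _ /imsetP[B CB ->].
  by rewrite card_imset; [exact: C2 | exact: perm_inj].
apply/and3P; split.
- rewrite eqEsubset subsetT /=; apply/subsetP => x _.
  have : (s^-1)%g x \in cover C by rewrite covC inE.
  case/bigcupP => B CB xB; apply/bigcupP; exists (s @: B); first exact: imset_f.
  by apply/imsetP; exists ((s^-1)%g x); rewrite ?permKV.
- apply/trivIsetP => _ _ /imsetP[A CA ->] /imsetP[B CB ->] neqAB.
  rewrite imset_disjoint; last exact: perm_inj.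
  by apply: (trivIsetP trivC) => //; apply: contraNneq neqAB => ->.
- by apply/imsetP => -[B CB /esym/eqP]; rewrite imset_eq0 => /eqP B0;
     rewrite -B0 CB in C0.
Qed.

Definition chord_diagram_act (k : nat) (C : chord_diagram k) (s : 'S_(k.*2)) :
  chord_diagram k := ChordDiagram (chord_diagram_act_subproof C s).

(* Elements of Q D(2k) are row vectors indexed by the enumeration of D(2k),
   operators act on them by right multiplication, and a subspace is the row space
   of a square matrix. *)
Notation QD k := 'rV[rat]_#|{: chord_diagram k}|.
Notation endQD k := 'M[rat]_#|{: chord_diagram k}|.

(* Only the connected components matter, so that parallel edges of the union
   graph need not be distinguished. *)
Definition union_graph (k : nat) (C D : chord_diagram k) : rel 'I_k.*2 :=
  fun x y => ([set x; y] \in chords C) || ([set x; y] \in chords D).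

Definition union_components (k : nat) (C D : chord_diagram k) : nat :=
  n_comp (union_graph C D) [set: 'I_k.*2].

(* The number of components is at most k, so the subtraction does not
   truncate. *)
Definition pairing (g k : nat) (C D : chord_diagram k) : rat :=
  let r := union_components C D in (-1) ^+ (k - r) * (2 * g%:R) ^+ r.

Definition intersection_mx (g k : nat) : endQD k :=
  \matrix_(i, j) pairing g (enum_val i) (enum_val j).

Definition intersection_form (g k : nat) (u v : QD k) : rat :=
  (u *m intersection_mx g k *m v^T) 0 0.

Definition possemidef_mx (R : realDomainType) (n : nat) (A : 'M[R]_n) : Prop :=
  A^T = A /\ forall x : 'rV[R]_n, 0 <= (x *m A *m x^T) 0 0.

Definition chord_perm_mx (k : nat) (s : 'S_(k.*2)) : endQD k :=
  \matrix_(i, j) (enum_val j == chord_diagram_act (enum_val i) s)%:R.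

Lemma chord_perm_mx_repr (k : nat) :
  mx_repr [set: 'S_(k.*2)] (@chord_perm_mx k).
Proof.
have act1 (C : chord_diagram k) : chord_diagram_act C 1%g = C.
  apply: val_inj; rewrite /= -[RHS]imset_id; apply: eq_imset => A /=.
  by rewrite -[RHS]imset_id; apply: eq_imset => x; rewrite perm1.
have actM (C : chord_diagram k) s t :
    chord_diagram_act C (s * t)%g = chord_diagram_act (chord_diagram_act C s) t.
  apply: val_inj; rewrite /= -imset_comp; apply: eq_imset => A /=.
  by rewrite -imset_comp; apply: eq_imset => x /=; rewrite permM.
split=> [|s t _ _]; apply/matrixP => i j; rewrite !mxE.
  by rewrite act1 (inj_eq enum_val_inj) eq_sym.
rewrite (bigD1 (enum_rank (chord_diagram_act (enum_val i) s))) //= !mxE.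
rewrite enum_rankK eqxx mul1r actM big1 ?addr0 // => l ne_l; rewrite !mxE.
case: eqP => [e|_]; last by rewrite mul0r.
by rewrite -e enum_valK eqxx in ne_l.
Qed.

Definition chord_repr (k : nat) :
    mx_representation rat [set: 'S_(k.*2)] #|{: chord_diagram k}| :=
  MxRepresentation (chord_perm_mx_repr k).

Definition is_young (n : nat) (s : seq nat) : bool :=
  [&& sorted geq s, 0 \notin s & sumn s == n]%N.

Record young (n : nat) := Young {
  rows :> seq nat;
  _ : is_young n rows
}.
HB.instance Definition _ n := [isSub for @rows n].
HB.instance Definition _ n := [Countable of young n by <:].

(* A Young diagram of size n has at most n rows, each of length at most n;
   this embeds young n into a finite type. *)
Definition young_code (n : nat) (l : young n) : n.-bseq 'I_n.+1 :=
  insub_bseq n [seq inord i | i <- l].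

Definition young_decode (n : nat) (s : n.-bseq 'I_n.+1) : option (young n) :=
  insub [seq nat_of_ord i | i <- s].

Lemma young_codeK (n : nat) : pcancel (@young_code n) (@young_decode n).
Proof.
move=> l; have /and3P[_ l0 /eqP sl] := valP l.
have le_sum (t : seq nat) : all (fun i => i <= sumn t)%N t.
  elim: t => //= i t IHt; rewrite leq_addr.
  by apply: sub_all IHt => j /leq_trans; apply; rewrite leq_addl.
have le_size (t : seq nat) : 0%N \notin t -> (size t <= sumn t)%N.
  elim: t => //= i t IHt; rewrite inE negb_or => /andP[i0 /IHt le_t].
  by rewrite -add1n leq_add // lt0n eq_sym.
have sz : (size [seq inord i : 'I_n.+1 | i <- l] <= n)%N.
  by rewrite size_map -[leqRHS]sl le_size.
rewrite /young_decode /young_code.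
have -> : [seq nat_of_ord i | i <- insub_bseq n [seq inord i : 'I_n.+1 | i <- l]]
          = rows l.
  rewrite (_ : val (insub_bseq n _) = [seq inord i : 'I_n.+1 | i <- l]).
    rewrite -map_comp -[RHS]map_id; apply/eq_in_map => i /= li.
    by rewrite inordK // ltnS -sl; apply: (allP (le_sum _)).
  by rewrite /insub_bseq val_insubd sz.
exact: valK.
Qed.
HB.instance Definition _ n : isFinite (young n) :=
  PCanIsFinite (@young_codeK n).

Lemma young_double_subproof (n : nat) (l : young n) :
  is_young n.*2 [seq i.*2 | i <- l].
Proof.
have /and3P[l_sorted l0 /eqP sl] := valP l; apply/and3P; split.
- rewrite sorted_map; apply: sub_sorted l_sorted => i j /=.
  by rewrite leq_double.
- by apply: contra l0 => /mapP[[|i] // li _].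
- apply/eqP; transitivity (sumn l).*2; last by rewrite sl.
  by elim: (rows l) => //= i t ->; rewrite doubleD.
Qed.

(* The diagram 2 lambda. *)
Definition young_double (n : nat) (l : young n) : young n.*2 :=
  Young (young_double_subproof l).

(* The index t runs over rows and s over columns: the box (t, s) has t rows
   above it and s columns to its left. *)
Definition chord_eigenvalue (g k : nat) (l : young k) : rat :=
  \prod_(t < size l) \prod_(s < nth 0%N l t) (2 * g%:R - 2 * s%:R + t%:R).

(* In the canonical tableau of shape l the boxes are numbered 0, 1, ..., n-1
   along the rows, from top to bottom; box_row and box_col locate the box
   numbered i. *)
Definition box_row (n : nat) (l : young n) (i : 'I_n) : nat :=
  reshape_index l i.
Definition box_col (n : nat) (l : young n) (i : 'I_n) : nat :=
  reshape_offset l i.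

Definition row_stabilizer (n : nat) (l : young n) : {set 'S_n} :=
  [set p : 'S_n | [forall i, box_row l (p i) == box_row l i]].
Definition col_stabilizer (n : nat) (l : young n) : {set 'S_n} :=
  [set q : 'S_n | [forall i, box_col l (q i) == box_col l i]].

(* The Young symmetrizer c = (sum_p p) (sum_q sgn(q) q), as an element of the
   regular representation of 'S_n.  In 'S_n the product (q * p)%g applies q
   first, so that (q * p)%g is the composite usually written p q, and the left
   ideal Q[S_n] c of the usual convention becomes the right submodule generated
   by c. *)
Definition young_symmetrizer (n : nat) (l : young n) :
    'rV[rat]_#|[set: 'S_n]%G| :=
  gring_row (\sum_(p in row_stabilizer l) \sum_(q in col_stabilizer l)
    (-1) ^+ odd_perm q *: regular_repr rat [set: 'S_n]%G (q * p)%g).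

Definition specht_mx (n : nat) (l : young n) :=
  cyclic_mx (regular_repr rat [set: 'S_n]%G) (young_symmetrizer l).

Definition specht_repr (n : nat) (l : young n) :
    mx_representation rat [set: 'S_n] (\rank (specht_mx l)) :=
  submod_repr (cyclic_mx_module (regular_repr rat [set: 'S_n]%G)
                                (young_symmetrizer l)).

(* Main.v *)
(* With q = -2g the pairing is <C,D> = (-1)^k q^r.  Let C0 be the diagram with
   chords {2j, 2j+1} and let J_i be the sum of the transpositions (j i), j < i.
   Adding the chords one at a time gives
     sum_D q^(r(C0,D)) D = (q + J_0) (q + J_2) ... (q + J_(2k-2)) C0.
   Write a for the row symmetrizer and b for the column antisymmetrizer of the
   canonical tableau.  A Garnir-type argument gives J_i a b = ct(i) a b, ct(i)
   being the content (column minus row) of the box i.  For the shape 2 lambda,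
   the vector v = a b C0 has a positive coefficient at C0: if p q C0 = C0 with p
   in the row and q in the column stabilizer, then q commutes with i <-> i xor 1,
   so q is even.  Comparing the coefficients of C0 in M v = mu v therefore gives
   mu as the product of the -(q + ct(2j)).

   E_lambda is the module generated by v.  By von Neumann's lemma it is simple
   and isomorphic to the Specht module, and by dominance a b x a' b' = 0 for
   distinct shapes, so that the E_lambda are independent.  The orbits of pairs of
   diagrams are classified by the half-lengths of the cycles of C + D, a
   partition of k; hence the commutant has dimension at most the number of
   partitions of k.  So it is spanned by the projections onto the E_lambda, which
   gives both the completeness of the decomposition and the fact that M acts by
   a scalar on each E_lambda. *)

Require Import Defs.
From HB Require Import structures.
From mathcomp Require Import all_boot all_order all_fingroup all_algebra.
From mathcomp Require Import pgroup mxrepresentation.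
Import Order.TTheory GRing.Theory Num.Theory.
Local Open Scope ring_scope.

Set Implicit Arguments.
Unset Strict Implicit.
Unset Printing Implicit Defensive.

(** * Boxes and dominance *)

Section Boxes.
Variable n : nat.
Implicit Types (l m : young n) (i j : 'I_n).

Lemma ltn_sumn_young l i : (i < sumn l)%N.
Proof. by have /and3P[_ _ /eqP->] := valP l. Qed.

Lemma ltn_box_col l i : (box_col l i < nth 0 l (box_row l i))%N.
Proof. exact/reshape_offsetP/ltn_sumn_young. Qed.

Lemma box_inj l i j :
  box_row l i = box_row l j -> box_col l i = box_col l j -> i = j.
Proof.
rewrite /box_row /box_col => er ec; apply: ord_inj.
by rewrite -(reshape_indexK l i) er ec reshape_indexK.
Qed.

(** The inverse of the pair of maps [box_row], [box_col]; the cast replaces [sumn l] by [n]. *)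
Definition box_at l t (c : 'I_(nth 0%N l t)) : 'I_n :=
  cast_ord (eqP (let: And3 _ _ h := and3P (valP l) in h))
    (Ordinal (flatten_indexP (ltn_ord c))).

Lemma box_row_at l t (c : 'I_(nth 0%N l t)) : box_row l (box_at c) = t.
Proof. exact: flatten_indexKl. Qed.

Lemma box_col_at l t (c : 'I_(nth 0%N l t)) : box_col l (box_at c) = c.
Proof. exact: flatten_indexKr. Qed.

Lemma box_exists l t c : (c < nth 0 l t)%N ->
  exists i, box_row l i = t /\ box_col l i = c.
Proof.
by move=> ltc; exists (box_at (Ordinal ltc)); rewrite box_row_at box_col_at.
Qed.

Lemma nth_young_leq l t u : (u <= t)%N -> (nth 0 l t <= nth 0 l u)%N.
Proof.
have /and3P[srt _ _] := valP l => le_ut.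
have [lt_t|/(nth_default _)-> //] := ltnP t (size l).
have geq_trans : transitive geq by move=> x y z xy zx; apply: leq_trans zx xy.
apply: (sorted_leq_nth geq_trans leqnn 0%N srt u t) => //.
by rewrite inE (leq_ltn_trans le_ut).
Qed.

Lemma box_above l i u : (u <= box_row l i)%N ->
  exists j, box_row l j = u /\ box_col l j = box_col l i.
Proof.
move=> le_u; apply: box_exists.
exact: leq_trans (ltn_box_col l i) (nth_young_leq l le_u).
Qed.

Lemma box_left l i c : (c <= box_col l i)%N ->
  exists j, box_row l j = box_row l i /\ box_col l j = c.
Proof. by move=> le_c; apply/box_exists/leq_ltn_trans/ltn_box_col. Qed.

Lemma card_box_row l t : #|[set i | box_row l i == t]| = nth 0%N l t.
Proof.
rewrite -[RHS]card_ord -(card_imset xpredT (_ : injective (@box_at l t))).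
  apply: eq_card => i; rewrite inE; apply/eqP/imsetP => [<-|[c _ ->]].
    exists (Ordinal (ltn_box_col l i)) => //; apply: (@box_inj l).
      by rewrite box_row_at.
    by rewrite box_col_at.
  exact: box_row_at.
by move=> c d /(congr1 (box_col l)); rewrite !box_col_at => /ord_inj.
Qed.

Lemma box_ltn l i j :
  (j < i)%N = (box_row l j < box_row l i)%N
           || (box_row l j == box_row l i) && (box_col l j < box_col l i)%N.
Proof.
rewrite ltnNge (reshape_leq l) -/(box_row l i) -/(box_row l j).
rewrite -/(box_col l i) -/(box_col l j) negb_or negb_and.
by case: (ltngtP (box_row l i)); rewrite //= -?ltnNge.
Qed.

(** The partial sum of the first [t] row lengths; comparing these sums for all [t] is the dominance
    order. *)
Definition rows_above l t := #|[set i | (box_row l i < t)%N]|.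

Lemma rows_aboveS l t : rows_above l t.+1 = (rows_above l t + nth 0 l t)%N.
Proof.
rewrite /rows_above -card_box_row -cardsUI.
rewrite [_ :&: _](_ : _ = set0) ?cards0 ?addn0.
  by apply: eq_card => i; rewrite !inE ltnS leq_eqVlt orbC.
by apply/setP => i; rewrite !inE; case: ltngtP.
Qed.

Lemma rows_above_inj l m : rows_above l =1 rows_above m -> l = m.
Proof.
move=> eq_lm; have eq_nth t : nth 0%N l t = nth 0%N m t.
  by move: (eq_lm t.+1); rewrite !rows_aboveS eq_lm => /addnI.
have sz (u v : young n) : (forall t, nth 0%N u t = nth 0%N v t) ->
    (size u <= size v)%N.
  move=> euv; rewrite leqNgt; apply/negP => lt_vu.
  have /and3P[_ u0 _] := valP u; have := mem_nth 0%N lt_vu.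
  by rewrite euv nth_default // (negPf u0).
apply/val_inj/(@eq_from_nth _ 0%N) => [|t _]; last exact: eq_nth.
by apply/eqP; rewrite eqn_leq !sz.
Qed.

Section Dominance.
Variables (l m : young n) (g : 'S_n).

(** The condition on [g] that a nonzero product of the row symmetrizer of [l], [g] and the column
    antisymmetrizer of [m] imposes. Such a [g] can only exist if [m] dominates [l]. *)
Definition rows_split :=
  forall i j, i != j -> box_row l i = box_row l j ->
    box_col m (g i) <> box_col m (g j).

Hypothesis spread : rows_split.

Let S c t := [set i | (box_col m (g i) == c) && (box_row l i < t)%N].
Let N c t := [set i | (box_col m i == c) && (box_row m i < t)%N].

Let col_ord i : 'I_n.+1 := inord (box_col m i).

Let col_ordK i : col_ord i = box_col m i :> nat.
Proof.
rewrite inordK // ltnS ltnW // (leq_trans (ltn_box_col m i)) //.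
by rewrite -card_box_row -[leqRHS]card_ord max_card.
Qed.

Let rows_aboveS_sum t : rows_above l t = (\sum_(c < n.+1) #|S c t|)%N.
Proof.
rewrite /rows_above -sum1_card (partition_big (fun i => col_ord (g i)) xpredT) //=.
apply: eq_bigr => c _; rewrite -sum1_card; apply: eq_bigl => i.
by rewrite !inE andbC -val_eqE /= col_ordK.
Qed.

Let rows_aboveN_sum t : rows_above m t = (\sum_(c < n.+1) #|N c t|)%N.
Proof.
rewrite /rows_above -sum1_card (partition_big col_ord xpredT) //=.
apply: eq_bigr => c _; rewrite -sum1_card; apply: eq_bigl => i.
by rewrite !inE andbC -val_eqE /= col_ordK.
Qed.

Let leq_S_col c t : (#|S c t| <= #|[set i | box_col m i == c]|)%N.
Proof.
rewrite -(card_imset _ (@perm_inj _ g)); apply/subset_leq_card/subsetP => i.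
by case/imsetP => j; rewrite !inE => /andP[ej _] ->.
Qed.

(** If column [c] of [m] has a box in row [t] or below, it has [t] boxes above row [t], while each
    of the first [t] rows of [l] sends at most one box to column [c]. Otherwise [N c t] is the whole
    column. *)
Let leq_S_N c t : (#|S c t| <= #|N c t|)%N.
Proof.
have [i /andP[/eqP ci le_ti]|noN] :=
    pickP (fun i => (box_col m i == c) && (t <= box_row m i)%N); last first.
  rewrite (_ : N c t = [set i | box_col m i == c]) ?leq_S_col //.
  apply/setP => i; rewrite !inE; case: eqP => //= ci.
  by have := noN i; rewrite ci eqxx /= ltnNge => ->.
have [->|t0] := posnP t.
  by rewrite (_ : S c 0 = set0) ?cards0 //; apply/setP => j; rewrite !inE andbF.
have card_le (A : {set 'I_n}) (r : 'I_n -> nat) :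
    {in A &, injective r} -> {in A, forall j, r j < t}%N -> (#|A| <= t)%N.
  move=> injr rA; pose f j : 'I_t := insubd (Ordinal t0) (r j).
  have fE j : j \in A -> f j = r j :> nat by move=> /rA; rewrite val_insubd => ->.
  rewrite -(card_in_imset (_ : {in A &, injective f})); last first.
    move=> j1 j2 A1 A2 /(congr1 val) /=; rewrite !fE //; exact: injr.
  by rewrite -[leqRHS]card_ord max_card.
apply: leq_trans (_ : t <= _)%N.
  apply: (card_le _ (box_row l)) => [i1 i2|j]; last by rewrite !inE => /andP[].
  rewrite !inE => /andP[/eqP c1 _] /andP[/eqP c2 _] er; apply/eqP/contraT.
  by move=> /spread /(_ er); rewrite c1 c2.
have H (u : 'I_t) : exists j, (box_row m j == u) && (box_col m j == c).
  have [j [rj cj]] := box_above (leq_trans (ltnW (ltn_ord u)) le_ti).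
  by exists j; rewrite rj cj ci !eqxx.
have injH : injective (fun u : 'I_t => xchoose (H u)).
  move=> u v e; apply: ord_inj; have /andP[/eqP eu _] := xchooseP (H u).
  by have /andP[/eqP ev _] := xchooseP (H v); rewrite -eu -ev e.
rewrite -[leqLHS]card_ord -(card_imset xpredT injH).
apply/subset_leq_card/subsetP => _ /imsetP[u _ ->]; rewrite inE.
by have /andP[/eqP-> ->] := xchooseP (H u); rewrite ltn_ord.
Qed.

Lemma rows_split_dominance t : (rows_above l t <= rows_above m t)%N.
Proof. by rewrite rows_aboveS_sum rows_aboveN_sum leq_sum. Qed.

(** Equal partial sums make the bound [leq_S_N] tight in every column. If column [c] of [m] had no
    box in row [t], going from [t] to [t.+1] would add [i] to [S c t] and nothing to [N c t],
    against the bound. *)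
Lemma rows_split_col_leq i : rows_above l =1 rows_above m ->
  (box_col m (g i) < nth 0 m (box_row l i))%N.
Proof.
move=> eq_lm; set t := box_row l i; set c := box_col m (g i).
rewrite ltnNge; apply/negP => le_c.
have lt_c : (c < n.+1)%N by rewrite /c -col_ordK.
have eqSN : #|S c t| = #|N c t|.
  have := eq_lm t; rewrite rows_aboveS_sum rows_aboveN_sum => /eqP.
  have /leqif_sum/= -> : forall u : 'I_n.+1, xpredT u ->
      (#|S u t| <= #|N u t| ?= iff (#|S u t| == #|N u t|))%N.
    by move=> u _; split; first exact: leq_S_N.
  by move=> /forallP/(_ (Ordinal lt_c))/eqP.
have : (#|S c t| < #|S c t.+1|)%N.
  apply/proper_card/properP; split.
    by apply/subsetP => j; rewrite !inE => /andP[-> /ltnW].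
  by exists i; rewrite !inE eqxx /= ?ltnS ?leqnn ?ltnn.
rewrite eqSN ltnNge; case/negP; apply: leq_trans (leq_S_N _ _) _.
apply/subset_leq_card/subsetP => j; rewrite !inE => /andP[/eqP cj].
rewrite cj eqxx ltnS leq_eqVlt => /orP[/eqP rj|//].
by have := ltn_box_col m j; rewrite cj rj ltnNge le_c.
Qed.

End Dominance.

(** The permutation [p] moves each box [i] within its row to the column of [g i]. The target box
    exists by [rows_split_col_leq], and [p] is injective because [g] splits the rows. *)
Lemma rows_split_factor l g : rows_split l l g ->
  exists2 p, p \in row_stabilizer l & (p^-1 * g)%g \in col_stabilizer l.
Proof.
move=> spread.
have ex i : exists j, (box_row l j == box_row l i) && (box_col l j == box_col l (g i)).
  have [j [rj cj]] := box_exists (rows_split_col_leq spread i (fun t => erefl)).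
  by exists j; rewrite rj cj !eqxx.
pose f i := xchoose (ex i).
have rf i : box_row l (f i) = box_row l i.
  by have /andP[/eqP->] := xchooseP (ex i).
have cf i : box_col l (f i) = box_col l (g i).
  by have /andP[_ /eqP->] := xchooseP (ex i).
have injf : injective f.
  move=> i j eij; apply/eqP/contraT => /spread; rewrite -!cf -(rf i) -(rf j) eij.
  by move=> /(_ erefl).
exists (perm injf); rewrite !inE; apply/forallP => i; first by rewrite permE rf.
by rewrite permM -[X in _ == box_col l X](permKV (perm injf))
  [X in _ == box_col l X]permE cf.
Qed.

End Boxes.

(** * Row and column symmetrizers *)

Section Stabilizers.
Variables (n : nat) (l : young n).

Let stab_group (T : eqType) (f : 'I_n -> T) :
  group_set [set p : 'S_n | [forall i, f (p i) == f i]].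
Proof.
apply/group_setP; split=> [|p q]; first by rewrite inE; apply/forallP => i; rewrite perm1.
rewrite !inE => /forallP hp /forallP hq; apply/forallP => i.
by rewrite permM (eqP (hq _)).
Qed.

Lemma row_stabilizer_group_set : group_set (row_stabilizer l).
Proof. exact: stab_group. Qed.
Canonical row_stabilizer_group := Group row_stabilizer_group_set.

Lemma col_stabilizer_group_set : group_set (col_stabilizer l).
Proof. exact: stab_group. Qed.
Canonical col_stabilizer_group := Group col_stabilizer_group_set.

Lemma row_stabilizerP (p : 'S_n) :
  reflect (forall i, box_row l (p i) = box_row l i) (p \in row_stabilizer l).
Proof. by rewrite inE; apply: (iffP forallP) => h i; apply/eqP. Qed.

Lemma col_stabilizerP (p : 'S_n) :
  reflect (forall i, box_col l (p i) = box_col l i) (p \in col_stabilizer l).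
Proof. by rewrite inE; apply: (iffP forallP) => h i; apply/eqP. Qed.

Lemma row_stabilizer_tperm i j :
  box_row l i = box_row l j -> tperm i j \in row_stabilizer l.
Proof. by move=> e; apply/row_stabilizerP => u; case: tpermP => // ->. Qed.

Lemma col_stabilizer_tperm i j :
  box_col l i = box_col l j -> tperm i j \in col_stabilizer l.
Proof. by move=> e; apply/col_stabilizerP => u; case: tpermP => // ->. Qed.

End Stabilizers.

Section Symmetrizers.
Variables (n d : nat) (rG : mx_representation rat [set: 'S_n] d).
Implicit Types (l m : young n) (x g p q : 'S_n).

Definition row_sym l : 'M_d := \sum_(p in row_stabilizer l) rG p.
Definition col_sym l : 'M_d :=
  \sum_(q in col_stabilizer l) (-1) ^+ odd_perm q *: rG q.
Definition young_sym l : 'M_d := col_sym l *m row_sym l.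

Lemma reprM x y : rG (x * y)%g = rG x *m rG y.
Proof. by rewrite repr_mxM ?inE. Qed.

Lemma young_symE l : young_sym l =
  \sum_(p in row_stabilizer l) \sum_(q in col_stabilizer l)
    (-1) ^+ odd_perm q *: rG (q * p)%g.
Proof.
rewrite /young_sym mulmx_sumr; apply: eq_bigr => p _.
by rewrite mulmx_suml; apply: eq_bigr => q _; rewrite -scalemxAl reprM.
Qed.

Lemma mul_row_sym l p : p \in row_stabilizer l -> rG p *m row_sym l = row_sym l.
Proof.
move=> Rp; rewrite /row_sym mulmx_sumr [RHS](reindex_inj (mulgI p)) /=.
by apply: eq_big => q; rewrite ?groupMl // => _; rewrite reprM.
Qed.

Lemma row_sym_mul l p : p \in row_stabilizer l -> row_sym l *m rG p = row_sym l.
Proof.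
move=> Rp; rewrite /row_sym mulmx_suml [RHS](reindex_inj (mulIg p)) /=.
by apply: eq_big => q; rewrite ?groupMr // => _; rewrite reprM.
Qed.

Lemma mul_col_sym l q : q \in col_stabilizer l ->
  rG q *m col_sym l = (-1) ^+ odd_perm q *: col_sym l.
Proof.
move=> Cq; rewrite /col_sym mulmx_sumr scaler_sumr [RHS](reindex_inj (mulgI q)) /=.
apply: eq_big => p; rewrite ?groupMl // => _.
by rewrite odd_permM reprM scalerA signr_addb mulrA -expr2 sqrr_sign mul1r scalemxAr.
Qed.

Lemma col_sym_mul l q : q \in col_stabilizer l ->
  col_sym l *m rG q = (-1) ^+ odd_perm q *: col_sym l.
Proof.
move=> Cq; rewrite /col_sym mulmx_suml scaler_sumr [RHS](reindex_inj (mulIg q)) /=.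
apply: eq_big => p; rewrite ?groupMr // => _.
by rewrite odd_permM reprM scalerA signr_addb mulrC -mulrA -expr2 sqrr_sign mulr1
  scalemxAl.
Qed.

Lemma eq_oppmx_0 (A : 'M[rat]_d) : A = - A -> A = 0.
Proof.
move=> e; apply/matrixP => i j; move/matrixP/(_ i j): e; rewrite !mxE.
by move=> /eqP; rewrite -addr_eq0 -mulr2n mulrn_eq0 => /eqP.
Qed.

(** If [g] sends two boxes of one row to one column, their transposition is absorbed by the row
    symmetrizer; carried across [g], it lies in the column stabilizer and costs a sign. The product
    then equals its opposite. *)
Lemma row_col_sym_neq0 l m g :
  row_sym l *m rG g *m col_sym m != 0 -> rows_split l m g.
Proof.
move=> nz i j nij eij cij; case/eqP: nz; apply: eq_oppmx_0.
rewrite -{1}(row_sym_mul (row_stabilizer_tperm eij)) -!mulmxA.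
have -> : rG (tperm i j) *m (rG g *m col_sym m) =
          rG g *m (rG (tperm (g i) (g j)) *m col_sym m).
  by rewrite !mulmxA -!reprM -tpermJ -conjgC.
rewrite mul_col_sym ?col_stabilizer_tperm // odd_tperm (inj_eq perm_inj) nij.
by rewrite expr1 scaleN1r !mulmxN.
Qed.

Lemma col_row_sym_neq0 l m g :
  col_sym m *m rG g *m row_sym l != 0 -> rows_split l m g^-1.
Proof.
move=> nz i j nij eij cij; case/eqP: nz; apply: eq_oppmx_0.
rewrite -{1}(mul_row_sym (row_stabilizer_tperm eij)).
rewrite !mulmxA -[in LHS](mulmxA (col_sym m)) -reprM.
have -> : (g * tperm i j = tperm (g^-1 i) (g^-1 j) * g)%g.
  by rewrite -tpermJ conjgE invgK -!mulgA mulVg mulg1.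
rewrite reprM mulmxA col_sym_mul ?col_stabilizer_tperm //.
by rewrite odd_tperm (inj_eq perm_inj) nij expr1 scaleN1r !mulNmx.
Qed.

Lemma sandwich_sum l (A : 'M[rat]_d) m (B : 'M[rat]_d) x :
  A *m (row_sym l *m rG x *m col_sym m) *m B =
  \sum_(p in row_stabilizer l) \sum_(q in col_stabilizer m)
     (-1) ^+ odd_perm q *: (A *m rG (p * x * q)%g *m B).
Proof.
rewrite /row_sym /col_sym !mulmx_suml mulmx_sumr mulmx_suml.
apply: eq_bigr => p _; rewrite !mulmx_sumr mulmx_suml; apply: eq_bigr => q _.
by rewrite -!scalemxAr -scalemxAl !reprM.
Qed.

End Symmetrizers.

Lemma dominance_anti n (l m : young n) g h :
  rows_split l m g -> rows_split m l h -> l = m.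
Proof.
move=> lm ml; apply: rows_above_inj => t; apply/eqP.
by rewrite eqn_leq (rows_split_dominance lm) (rows_split_dominance ml).
Qed.

(** * Products of two Young symmetrizers *)

Section Orthogonality.
Variables (n d : nat) (rG : mx_representation rat [set: 'S_n] d).
Implicit Types (l m : young n) (x : 'S_n).

(** A nonzero product has a nonzero middle factor, which splits the rows of [l] into the columns of
    [m]. Expanding that factor leaves a nonzero product of the outer ones, which splits the rows of
    [m] into the columns of [l]. Dominance then forces [l = m]. *)
Lemma young_sym_ortho l m x : l != m ->
  young_sym rG l *m rG x *m young_sym rG m = 0.
Proof.
move=> nlm; apply/eqP/contraT; rewrite /young_sym.
rewrite (_ : _ *m _ = col_sym rG l *m (row_sym rG l *m rG x *m col_sym rG m)
  *m row_sym rG m); last by rewrite !mulmxA.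
move=> nz.
have [/eqP z|/row_col_sym_neq0 lm] := boolP (row_sym rG l *m rG x *m col_sym rG m == 0).
  by rewrite z mulmx0 mul0mx eqxx in nz.
case/eqP: nz; rewrite sandwich_sum big1 // => p _; rewrite big1 // => q _.
apply/eqP; rewrite scaler_eq0; apply/orP; right; apply/contraT.
by move=> /col_row_sym_neq0 ml; rewrite (dominance_anti lm ml) eqxx in nlm.
Qed.

Lemma row_sym_factor_neq0 l (A B : 'M[rat]_d) :
  A *m row_sym rG l *m B != 0 -> exists p, A *m rG p *m B != 0.
Proof.
move=> nz; have [p pP|no] := pickP (fun p : 'S_n => A *m rG p *m B != 0).
  by exists p.
case/eqP: nz; rewrite mulmx_sumr mulmx_suml big1 // => p _.
by apply/eqP/negbFE/no.
Qed.

(** Transposition reverses the two factors of a Young symmetrizer; this variant serves the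
    orthogonality for the standard dot product. *)
Lemma young_sym_ortho_tr l m x : l != m ->
  young_sym rG l *m rG x *m (row_sym rG m *m col_sym rG m) = 0.
Proof.
move=> nlm; apply/eqP/contraT; rewrite /young_sym => nz.
have [p lm] : exists p, row_sym rG l *m rG (x * p)%g *m col_sym rG m != 0.
  have [|p] := @row_sym_factor_neq0 m (row_sym rG l *m rG x) (col_sym rG m).
    apply: contraNneq nz => /(congr1 (mulmx (col_sym rG l))).
    by rewrite mulmx0 !mulmxA => ->.
  by rewrite -(mulmxA (row_sym rG l)) -reprM; exists p.
have [q ml] : exists q, col_sym rG l *m rG (q * x)%g *m row_sym rG m != 0.
  have [|q p0] := @row_sym_factor_neq0 l (col_sym rG l) (rG x *m row_sym rG m).
    apply: contraNneq nz => /(congr1 (mulmx^~ (col_sym rG m))).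
    by rewrite mul0mx !mulmxA => ->.
  by exists q; rewrite mulmxA -(mulmxA _ _ (rG x)) -reprM in p0.
by rewrite (dominance_anti (row_col_sym_neq0 lm) (col_row_sym_neq0 ml)) eqxx in nlm.
Qed.

End Orthogonality.

(** Either the inverse of [g] splits the rows, so that [g] is a column permutation followed by a row
    permutation, absorbed up to sign, or the product vanishes. The scalar is chosen before the
    representation, so that it can be transported from one representation to another. *)
Lemma col_row_sym_scalar n (l : young n) (g : 'S_n) : exists e : rat,
  forall d (rG : mx_representation rat [set: 'S_n] d),
  col_sym rG l *m rG g *m row_sym rG l = e *: young_sym rG l.
Proof.
have [sp|nsp] := boolP [forall i, forall j, (i != j) && (box_row l i == box_row l j) ==>
  (box_col l (g^-1 i)%g != box_col l (g^-1 j)%g)].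
  have /rows_split_factor[p Rp Cq] : rows_split l l g^-1.
    move=> i j nij /eqP eij /eqP; apply/negP.
    by move: sp => /forallP/(_ i)/forallP/(_ j); rewrite nij eij.
  have -> : g = ((p^-1 * g^-1)^-1 * p^-1)%g by rewrite invMg !invgK -mulgA mulgV mulg1.
  move: (p^-1 * g^-1)%g Cq => q Cq; exists ((-1) ^+ odd_perm q^-1%g) => d rG.
  rewrite reprM mulmxA -mulmxA mul_row_sym ?groupV //.
  by rewrite col_sym_mul ?groupV // -scalemxAl.
exists 0 => d rG; rewrite scale0r; apply/eqP/contraT => /col_row_sym_neq0 sp.
case/negP: nsp; apply/forallP => i; apply/forallP => j; apply/implyP.
by move=> /andP[nij /eqP eij]; apply/eqP/sp.
Qed.

(** Von Neumann's lemma: expanding the inner row and column sums leaves products to which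
    [col_row_sym_scalar] applies. *)
Lemma young_sym_scalar n (l : young n) : exists e : 'S_n -> rat,
  forall d (rG : mx_representation rat [set: 'S_n] d) x,
  young_sym rG l *m rG x *m young_sym rG l = e x *: young_sym rG l.
Proof.
have [e eP] := fin_all_exists (col_row_sym_scalar l).
exists (fun x => \sum_(p in row_stabilizer l) \sum_(q in col_stabilizer l)
  (-1) ^+ odd_perm q * e (p * x * q)%g) => d rG x.
rewrite {1 2}/young_sym (_ : _ *m _ = col_sym rG l *m
  (row_sym rG l *m rG x *m col_sym rG l) *m row_sym rG l); last by rewrite !mulmxA.
rewrite sandwich_sum scaler_suml; apply: eq_bigr => p _.
by rewrite scaler_suml; apply: eq_bigr => q _; rewrite eP scalerA.
Qed.

(** * Jucys-Murphy elements *)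

Section JucysMurphy.
Variables (n d : nat) (rG : mx_representation rat [set: 'S_n] d) (l : young n).

Definition jucys_murphy (i : 'I_n) : 'M[rat]_d :=
  \sum_(j : 'I_n | (j < i)%N) rG (tperm j i).

Lemma young_sym_tperm_row i j :
  box_row l i = box_row l j -> young_sym rG l *m rG (tperm i j) = young_sym rG l.
Proof. by move=> e; rewrite -mulmxA row_sym_mul ?row_stabilizer_tperm. Qed.

(** Moving the transposition to the left of a row permutation [p] turns it into one of the box [i0]
    that [p] sends to [i] with a box of row [t]. The box [u] of row [t] in the column of [i0] gives
    [-1]; the other boxes of row [t] contribute zero. *)
Lemma young_sym_garnir (i : 'I_n) t : (t < box_row l i)%N ->
  young_sym rG l *m (\sum_(j | box_row l j == t) rG (tperm j i)) = - young_sym rG l.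
Proof.
move=> lt_ti.
pose A i0 := \sum_(p in row_stabilizer l | p i0 == i) rG p.
have rowA : row_sym rG l = \sum_i0 A i0.
  rewrite /row_sym (partition_big (fun p : 'S_n => (p^-1)%g i) xpredT) //=.
  apply: eq_bigr => i0 _; apply: eq_bigl => p; congr (_ && _).
  by apply/eqP/eqP => <-; rewrite ?permKV ?permK.
have -> : young_sym rG l *m (\sum_(j | box_row l j == t) rG (tperm j i)) =
    \sum_i0 \sum_(j | box_row l j == t) col_sym rG l *m rG (tperm j i0) *m A i0.
  transitivity (col_sym rG l *m \sum_(p in row_stabilizer l)
      \sum_(j | box_row l j == t) rG (tperm j (p^-1 i)%g * p)%g).
    rewrite -mulmxA; congr (_ *m _); rewrite mulmx_suml; apply: eq_bigr => p Rp.
    rewrite mulmx_sumr (reindex_inj (@perm_inj _ p)) /=; apply: eq_big => j.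
      by rewrite (row_stabilizerP _ _ Rp).
    by rewrite -reprM -{1}[i](permKV p) -tpermJ -conjgC.
  rewrite (partition_big (fun p : 'S_n => (p^-1)%g i) xpredT) //= mulmx_sumr.
  apply: eq_bigr => i0 _; rewrite exchange_big /= mulmx_sumr.
  apply: eq_bigr => j _; rewrite /A -mulmxA; congr (_ *m _); rewrite mulmx_sumr.
  apply: eq_big => [p|p /andP[_ /eqP->]]; last by rewrite reprM.
  by congr (_ && _); apply/eqP/eqP => <-; rewrite ?permKV ?permK.
rewrite /young_sym rowA mulmx_sumr -sumrN; apply: eq_bigr => i0 _.
have [ei|nei] := eqVneq (box_row l i0) (box_row l i); last first.
  have A0 : A i0 = 0.
    apply: big_pred0 => p; apply: contraNF nei => /andP[/row_stabilizerP Rp].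
    by move=> /eqP <-; rewrite Rp.
  by rewrite A0 mulmx0 oppr0 big1 // => j _; rewrite mulmx0.
have [u [ru cu]] : exists u, box_row l u = t /\ box_col l u = box_col l i0.
  by apply: box_above; rewrite ei ltnW.
have nui : u != i0 by apply: contraTneq lt_ti => eui; rewrite -ei -eui ru ltnn.
have colt : col_sym rG l *m rG (tperm u i0) = - col_sym rG l.
  by rewrite col_sym_mul ?col_stabilizer_tperm // odd_tperm nui expr1 scaleN1r.
rewrite (bigD1 u) ?ru ?eqxx //= colt mulNmx big1 ?addr0 // => j /andP[/eqP rj nju].
have nji : j != i0 by apply: contraTneq lt_ti => eji; rewrite -ei -eji rj ltnn.
(* The 3-cycle [(u i0)(j i0) = (j i0)(u j)] absorbs into [A i0] on one side and
   changes the sign of [col_sym] on the other. *)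
have Aabs : rG (tperm u j) *m A i0 = A i0.
  have Rt : tperm u j \in row_stabilizer l.
    by apply: row_stabilizer_tperm; rewrite ru rj.
  rewrite /A mulmx_sumr [RHS](reindex_inj (mulgI (tperm u j))) /=.
  apply: eq_big => p; last by rewrite reprM.
  by rewrite groupMl // permM tpermD.
apply: eq_oppmx_0; rewrite -{1}[col_sym rG l]opprK -colt !mulNmx; congr (- _).
rewrite -(mulmxA _ (rG (tperm u i0))) -reprM conjgC tpermJ tpermR tpermD //.
  by rewrite reprM -!mulmxA Aabs.
by rewrite eq_sym.
Qed.

Lemma young_sym_rows_above (i : 'I_n) t : (t <= box_row l i)%N ->
  young_sym rG l *m (\sum_(j | (box_row l j < t)%N) rG (tperm j i)) =
  - t%:R *: young_sym rG l.
Proof.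
elim: t => [|t IHt] le_t; first by rewrite big_pred0 // mulmx0 oppr0 scale0r.
rewrite (bigID (fun j => box_row l j == t)) /= mulmxDr.
rewrite (eq_bigl (fun j => box_row l j == t)); last first.
  by move=> j; case: eqP => [->|]; rewrite ?ltnSn ?andbF.
rewrite young_sym_garnir //.
rewrite (eq_bigl (fun j => box_row l j < t)%N); last first.
  by move=> j; rewrite ltnS ltn_neqAle andbC.
by rewrite IHt ?(ltnW le_t) // -[- young_sym _ _]scaleN1r -scalerDl -opprD -natr1 addrC.
Qed.

Lemma young_sym_row_left (i : 'I_n) c : (c <= box_col l i)%N ->
  young_sym rG l *m (\sum_(j | (box_row l j == box_row l i) && (box_col l j < c)%N)
     rG (tperm j i)) = c%:R *: young_sym rG l.
Proof.
elim: c => [|c IHc] le_c.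
  by rewrite big_pred0 ?mulmx0 ?scale0r // => j; rewrite andbF.
have [u [ru cu]] := box_left (ltnW le_c).
rewrite (bigD1 u) /= ?ru ?cu ?eqxx ?ltnSn // mulmxDr young_sym_tperm_row //.
rewrite (eq_bigl (fun j => (box_row l j == box_row l i) && (box_col l j < c)%N)).
  by rewrite IHc ?(ltnW le_c) // -{1}[young_sym _ _]scale1r -scalerDl addrC natr1.
move=> j; case: eqP => //= rj; rewrite ltnS [RHS]ltn_neqAle andbC; congr (~~ _ && _).
apply/eqP/eqP => [->//|cj]; apply: (@box_inj _ l); first by rewrite rj ru.
by rewrite cj cu.
Qed.

(** The boxes numbered before [i] form the full rows above, each contributing [-1], and the boxes on
    the left in its row, each contributing [1]. The total is the content of the box. *)
Lemma young_sym_jucys_murphy (i : 'I_n) :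
  young_sym rG l *m jucys_murphy i =
  ((box_col l i)%:R - (box_row l i)%:R) *: young_sym rG l.
Proof.
rewrite /jucys_murphy (bigID (fun j => box_row l j < box_row l i)%N) /= mulmxDr.
rewrite (eq_bigl (fun j => box_row l j < box_row l i)%N); last first.
  by move=> j; rewrite (box_ltn l); case: (ltngtP (box_row l j)); rewrite ?andbF.
rewrite young_sym_rows_above // (eq_bigl (fun j =>
  (box_row l j == box_row l i) && (box_col l j < box_col l i)%N)); last first.
  by move=> j; rewrite (box_ltn l); case: (ltngtP (box_row l j)); rewrite ?andbF ?andbT.
by rewrite young_sym_row_left // -scalerDl addrC.
Qed.

End JucysMurphy.

(** * Cyclic modules generated by symmetrized vectors *)

Section CyclicModules.
Variables (n d : nat) (rG : mx_representation rat [set: 'S_n] d).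
Implicit Types (l m : young n) (u v w : 'rV[rat]_d).

Lemma cyclic_mx_repr u x : (u *m rG x <= cyclic_mx rG u)%MS.
Proof. by rewrite mxmodule_trans ?inE ?cyclic_mx_module ?cyclic_mx_id. Qed.

Lemma cyclic_mx_sum u v : (v <= cyclic_mx rG u)%MS ->
  exists a : 'S_n -> rat, v = \sum_x a x *: (u *m rG x).
Proof.
case/cyclic_mxP => A /envelop_mxP[a ->] ->; exists a; rewrite mulmx_sumr.
by apply: eq_big => [x|x _]; rewrite ?inE // -scalemxAr.
Qed.

Lemma cyclic_young_sym_ortho l m w v : l != m ->
  (v <= cyclic_mx rG (w *m young_sym rG l))%MS -> v *m young_sym rG m = 0.
Proof.
move=> nlm /cyclic_mx_sum[a ->]; rewrite mulmx_suml big1 // => x _.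
by rewrite -scalemxAl -!(mulmxA w) young_sym_ortho // mulmx0 scaler0.
Qed.

Lemma cyclic_young_sym_ortho_tr l m w v : l != m ->
  (v <= cyclic_mx rG (w *m young_sym rG l))%MS ->
  v *m (row_sym rG m *m col_sym rG m) = 0.
Proof.
move=> nlm /cyclic_mx_sum[a ->]; rewrite mulmx_suml big1 // => x _.
by rewrite -scalemxAl -!(mulmxA w) young_sym_ortho_tr // mulmx0 scaler0.
Qed.

Lemma cyclic_young_sym_line l w v :
  (v <= cyclic_mx rG (w *m young_sym rG l))%MS ->
  exists a, v *m young_sym rG l = a *: (w *m young_sym rG l).
Proof.
have [e eP] := young_sym_scalar l.
move=> /cyclic_mx_sum[a ->]; exists (\sum_x a x * e x).
rewrite mulmx_suml scaler_suml; apply: eq_bigr => x _.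
by rewrite -scalemxAl -scalerA -!(mulmxA w) eP -!scalemxAr.
Qed.

Lemma mxmodule_young_sym r (U : 'M[rat]_(r, d)) (W : 'M_d) l :
  mxmodule rG W -> (U <= W)%MS -> (U *m young_sym rG l <= W)%MS.
Proof.
move=> modW sUW; rewrite young_symE mulmx_sumr summx_sub // => p _.
rewrite mulmx_sumr summx_sub // => q _.
by rewrite -scalemxAr scalemx_sub // mxmodule_trans ?inE.
Qed.

Lemma pchar_rat_pgroup (A : {group 'S_n}) : pgroup [pchar rat]^' A.
Proof.
apply: sub_in_pnat (pnat_pi (cardG_gt0 A)) => p _ _.
by rewrite inE /= pchar_num.
Qed.

(** The symmetrizer maps the module into the line of its generator [v]. A submodule [U] not killed
    by it thus contains [v]. If [U] is killed, a nonzero multiple of [v] lies in a Maschke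
    complement [W] of [U]; then the whole module, [U] included, lies in [W], and [U] is zero. *)
Lemma cyclic_young_sym_simple l w :
  w *m young_sym rG l *m young_sym rG l != 0 ->
  mxsimple rG (cyclic_mx rG (w *m young_sym rG l)).
Proof.
set v := w *m young_sym rG l => nz; split; first exact: cyclic_mx_module.
  by rewrite cyclic_mx_eq0; apply: contraNneq nz => ->; rewrite mul0mx.
move=> U modU sUE nzU; apply: cyclic_mx_sub => //.
have [/eqP U0|/rowV0Pn[u]] := boolP (U *m young_sym rG l == 0); last first.
  case/submxP => D -> ; rewrite mulmxA => nzDU.
  have sDU : (D *m U <= U)%MS by exact: submxMl.
  have [a ea] := cyclic_young_sym_line (submx_trans sDU sUE).
  rewrite ea in nzDU; move: (mxmodule_young_sym l modU sDU).
  rewrite ea; apply: submx_trans; rewrite -/v in nzDU *.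
  have nza : a != 0 by apply: contraNneq nzDU => ->; rewrite scale0r.
  by rewrite -{1}[v](scalerK nza) scalemx_sub.
have [W modW defUW dxUW] := mx_Maschke_pchar rG (pchar_rat_pgroup _) modU (submx1 U).
have [a ea] := cyclic_young_sym_line (cyclic_mx_id rG v).
have nza : a != 0 by apply: contraNneq nz => a0; rewrite ea a0 scale0r.
suff sVW : (v <= W)%MS.
  have sUW : (U <= W)%MS by apply: submx_trans sUE (cyclic_mx_sub modW sVW).
  case/eqP: nzU; apply/eqP; rewrite -submx0 -(mxdirect_addsP dxUW) sub_capmx.
  by rewrite submx_refl.
rewrite -[v](scalerK nza) scalemx_sub // -ea.
have /sub_addsmxP[[x y] /= ->] : (v <= U + W)%MS by rewrite defUW submx1.
by rewrite mulmxDl -mulmxA U0 mulmx0 add0r mxmodule_young_sym ?submxMl.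
Qed.

End CyclicModules.

(** * Chord diagrams as involutions, components of unions *)

Section Partner.
Variable k : nat.
Implicit Types (C D : chord_diagram k) (x y z : 'I_k.*2) (s : 'S_k.*2).

(** The diagram as a fixed-point-free involution; the default [x] is never returned, every vertex
    being on a chord. *)
Definition partner C x : 'I_k.*2 :=
  odflt x [pick y | (y != x) && ([set x; y] \in chords C)].

Lemma chord_card2 C B : B \in chords C -> #|B| = 2.
Proof. by have /andP[_ /forall_inP C2] := valP C => /C2/eqP. Qed.

Lemma chord_neq C x y : [set x; y] \in chords C -> y != x.
Proof. by move=> /chord_card2; rewrite cards2 eq_sym; case: eqP. Qed.

Lemma chord_uniq C x y z :
  [set x; y] \in chords C -> [set x; z] \in chords C -> y = z.
Proof.
have /andP[/and3P[_ trivC _] _] := valP C => Cy Cz.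
have e : [set x; y] = [set x; z].
  by rewrite -(def_pblock trivC Cy (set21 x y)) (def_pblock trivC Cz (set21 x z)).
have : y \in [set x; z] by rewrite -e set22.
by rewrite !inE (negPf (chord_neq Cy)) => /eqP.
Qed.

Lemma chord_partner C x : [set x; partner C x] \in chords C.
Proof.
rewrite /partner; case: pickP => [y /andP[_ //]|no].
have /andP[/and3P[/eqP covC _ _] _] := valP C.
have : x \in cover C by rewrite covC inE.
case/bigcupP => B CB xB.
have /eqP/cards2P[a [b [nab eB]]] := chord_card2 CB.
move: xB CB; rewrite eB !inE => /orP[/eqP ex|/eqP ex] CB.
  by have := no b; rewrite ex CB eq_sym nab.
by have := no a; rewrite ex setUC CB nab.
Qed.

Lemma mem_chord C x y : ([set x; y] \in chords C) = (y == partner C x).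
Proof.
apply/idP/eqP => [Cy|->]; last exact: chord_partner.
exact: chord_uniq Cy (chord_partner C x).
Qed.

Lemma partner_neq C x : partner C x != x.
Proof. exact: chord_neq (chord_partner C x). Qed.

Lemma partnerK C : involutive (partner C).
Proof. by move=> x; apply/esym/eqP; rewrite -mem_chord setUC chord_partner. Qed.

Lemma partner_inj C : injective (partner C).
Proof. exact: inv_inj (partnerK C). Qed.

Lemma eq_partner C D : partner C =1 partner D -> C = D.
Proof.
move=> e; apply/val_inj/setP => B /=; have [|] := eqVneq #|B| 2.
  by move=> /eqP/cards2P[a [b [_ ->]]]; rewrite !mem_chord e.
by move=> nB; apply/idP/idP => /chord_card2 eB; rewrite eB in nB.
Qed.

Lemma partner_act C s x : partner (chord_diagram_act C s) (s x) = s (partner C x).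
Proof.
apply/esym/eqP; rewrite -mem_chord; apply/imsetP; exists [set x; partner C x].
  exact: chord_partner.
by rewrite imsetU1 imset_set1.
Qed.

Lemma union_graphE C D x y :
  union_graph C D x y = (y == partner C x) || (y == partner D x).
Proof. by rewrite /union_graph !mem_chord. Qed.

Lemma partner_sym C x y : (y == partner C x) = (x == partner C y).
Proof. by rewrite -!mem_chord setUC. Qed.

Lemma chord_diagram_act1 C : chord_diagram_act C 1%g = C.
Proof.
by apply: eq_partner => x; rewrite -{1}[x]perm1 partner_act perm1.
Qed.

Lemma chord_diagram_actM C s t :
  chord_diagram_act C (s * t)%g = chord_diagram_act (chord_diagram_act C s) t.
Proof.
apply: eq_partner => x; rewrite -[x](permKV (s * t)%g) partner_act.
by rewrite !permM !partner_act.
Qed.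

Lemma chord_diagram_actK s :
  cancel (fun C => chord_diagram_act C s) (fun C => chord_diagram_act C s^-1%g).
Proof. by move=> C; rewrite -chord_diagram_actM mulgV chord_diagram_act1. Qed.

Lemma chord_diagram_actKV s :
  cancel (fun C => chord_diagram_act C s^-1%g) (fun C => chord_diagram_act C s).
Proof. by move=> C; rewrite -chord_diagram_actM mulVg chord_diagram_act1. Qed.

End Partner.

(** A set closed under [e] is determined by the component roots that it contains, and these can be
    chosen freely. *)
Lemma card_invariant_set (T : finType) (e : rel T) : connect_sym e ->
  #|[set A : {set T} | [forall x, forall y, e x y ==> ((x \in A) == (y \in A))]]|
  = (2 ^ n_comp e [set: T])%N.
Proof.
move=> sym_e; pose R := [set x | roots e x].
have -> : n_comp e [set: T] = #|R| by apply: eq_card => x; rewrite !inE andbT.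
rewrite -card_powerset; pose f (B : {set T}) := [set x | fingraph.root e x \in B].
have injf : {in powerset R &, injective f}.
  move=> A B; rewrite !inE => /subsetP sA /subsetP sB /setP eAB; apply/setP => x.
  apply/idP/idP => xAB; move: (eAB x); rewrite !inE.
    by have := sA _ xAB; rewrite inE => /eqP->; rewrite xAB.
  by have := sB _ xAB; rewrite inE => /eqP->; rewrite xAB.
rewrite -(card_in_imset injf); apply: eq_card => A; rewrite !inE.
apply/forallP/imsetP => [invA|[B _ ->] x]; last first.
  apply/forallP => y; apply/implyP => /connect1 exy.
  by rewrite !inE (fingraph.rootP sym_e exy).
have invc x y : connect e x y -> (x \in A) = (y \in A).
  case/connectP => p; elim: p x => [|z p IHp] x /=; first by move=> _ ->.
  case/andP => exz ep ey; rewrite -(IHp z ep ey).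
  by have /forallP/(_ z) := invA x; rewrite exz => /eqP.
exists (A :&: R); first by rewrite inE subsetIr.
apply/setP => x; rewrite !inE -(invc _ _ (connect_root e x)).
by rewrite (roots_root sym_e) andbT.
Qed.

Section Components.
Variable k : nat.
Implicit Types (C D : chord_diagram k) (x y z : 'I_k.*2) (s : 'S_k.*2).

(* The unions of components; counting them amounts to counting components. *)
Definition unions C D := [set A : {set 'I_k.*2} |
  [forall x, ((partner C x \in A) == (x \in A)) && ((partner D x \in A) == (x \in A))]].

Lemma unionsP C D (A : {set 'I_k.*2}) :
  reflect (forall x, (partner C x \in A) = (x \in A) /\ (partner D x \in A) = (x \in A))
    (A \in unions C D).
Proof.
rewrite inE; apply: (iffP forallP) => h x; last by have [-> ->] := h x; rewrite !eqxx.
by have /andP[/eqP-> /eqP->] := h x.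
Qed.

Lemma card_unions C D : #|unions C D| = (2 ^ union_components C D)%N.
Proof.
rewrite /union_components -card_invariant_set; last first.
  apply: sym_connect_sym => x y.
  by rewrite !union_graphE partner_sym [y == partner D x]partner_sym.
apply: eq_card => A; apply/unionsP/idP => [h|].
  rewrite inE; apply/forallP => x; apply/forallP => y; apply/implyP.
  by rewrite union_graphE; have [h1 h2] := h x => /orP[] /eqP->; rewrite ?h1 ?h2.
rewrite inE => /forallP h x.
have /forallP/(_ (partner C x)) := h x; rewrite union_graphE eqxx => /eqP<-.
by have /forallP/(_ (partner D x)) := h x; rewrite union_graphE eqxx orbT => /eqP<-.
Qed.

Lemma eq_union_components C D C' D' :
  #|unions C D| = #|unions C' D'| -> union_components C D = union_components C' D'.
Proof. by rewrite !card_unions => /expnI; apply. Qed.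

Lemma union_componentsC C D : union_components C D = union_components D C.
Proof.
apply/eq_union_components/eq_card => A.
by apply/unionsP/unionsP => h x; have [] := h x.
Qed.

Lemma union_components_act C D s :
  union_components (chord_diagram_act C s) (chord_diagram_act D s) =
  union_components C D.
Proof.
apply: eq_union_components; rewrite -(card_imset _ (imset_inj (@perm_inj _ s^-1%g))).
apply: eq_card => A; apply/imsetP/unionsP => [[B /unionsP hB ->] x|hA].
  have inB z : (z \in (s^-1)%g @: B) = (s z \in B).
    by rewrite -{1}[z](permK s) mem_imset //; apply: perm_inj.
  by rewrite !inB -!partner_act; have [-> ->] := hB (s x).
exists (s @: A); last first.
  by rewrite -imset_comp (eq_imset _ (permK s)) imset_id.
apply/unionsP => x; rewrite -[x](permKV s) !partner_act !mem_imset ?hA //.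
all: exact: perm_inj.
Qed.

(** The common chord of [C] and [D] at [x] is a component by itself, and the transposition merges it
    with the component of [i]. The unions that survive are those that contain both or neither of [x]
    and [i]. Toggling [{x, y}] exchanges them with the others, so their number is halved. *)
Lemma union_components_tperm C D x i :
  partner C x = partner D x -> i != x -> i != partner C x ->
  (union_components C (chord_diagram_act D (tperm i x))).+1 = union_components C D.
Proof.
set y := partner C x => eD nix niy; set t := tperm i x.
have nyx : y != x := partner_neq C x.
have ty : t y = y by rewrite tpermD // eq_sym.
have tx : t x = i by rewrite tpermR.
have mem_t (A : {set 'I_k.*2}) z : (x \in A) = (i \in A) -> (t z \in A) = (z \in A).
  by move=> e; rewrite /t; case: tpermP => [->|->|]; rewrite // e.
pose U1 := [set A in unions C D | (x \in A) == (i \in A)].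
pose U2 := [set A in unions C D | (x \in A) != (i \in A)].
have eU1 : unions C (chord_diagram_act D t) = U1.
  apply/setP => A; rewrite [RHS]inE; apply/unionsP/andP => [h|[/unionsP h /eqP e] z].
    have exi : (x \in A) = (i \in A).
      have [<- _] := h x; rewrite -/y; have [_] := h i.
      by rewrite -tx partner_act -eD ty.
    split; last exact/eqP; apply/unionsP => z; split; first by have [] := h z.
    by rewrite -(mem_t A z) // -(mem_t A (partner D z)) // -partner_act; have [] := h (t z).
  split; first by have [] := h z.
  by rewrite -[z](permKV t) partner_act !mem_t //; have [_ ->] := h (t^-1 z)%g.
pose f (A : {set 'I_k.*2}) := [set z | (z \in A) (+) (z \in [set x; y])].
have fK : involutive f.
  by move=> A; apply/setP => z; rewrite !inE -addbA addbb addbF.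
have fU (A : {set 'I_k.*2}) : A \in unions C D -> f A \in unions C D.
  move=> /unionsP h; apply/unionsP => z; have [h1 h2] := h z; rewrite !inE h1 h2.
  have pxy E : partner E x = y ->
      (partner E z == x) || (partner E z == y) = (z == x) || (z == y).
    move=> eE; have eE' : partner E y = x by rewrite -eE partnerK.
    by rewrite ![partner E z == _]eq_sym !(partner_sym E z) eE eE' orbC.
  by rewrite !pxy.
have fxi (A : {set 'I_k.*2}) : ((x \in f A) == (i \in f A)) = ((x \in A) != (i \in A)).
  rewrite !inE eqxx (negPf nix) (negPf niy) /= addbT addbF.
  by case: (x \in A); case: (i \in A).
have card12 : #|U1| = #|U2|.
  rewrite -(card_imset _ (inv_inj fK)); apply: eq_card => A.
  apply/imsetP/idP => [[B U2B ->]|U2A].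
    move: U2B; rewrite [in X in X -> _]inE => /andP[/fU ufB eB].
    by rewrite inE ufB -fxi fK eB.
  move: U2A; rewrite [in X in X -> _]inE => /andP[uA nA].
  by exists (f A); rewrite ?fK // inE fU //= fxi.
apply: (@expnI 2) => //; rewrite -card_unions expnS -card_unions eU1 mul2n -addnn {2}card12.
rewrite -cardsUI [U1 :&: U2](_ : _ = set0) ?cards0 ?addn0.
  by apply: eq_card => A; rewrite !inE -andb_orr orbN andbT.
by apply/setP => A; rewrite !inE; case: eqP; rewrite ?andbF.
Qed.

End Components.

(** * The base diagram and doubled shapes *)

Section Flip.
Variable k : nat.
Implicit Types x y : 'I_k.*2.

Definition half_ord x : 'I_k := Ordinal (etrans (ltn_half_double x k) (ltn_ord x)).

Lemma flip_subproof x : ((if odd x then x.-1 else x.+1) < k.*2)%N.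
Proof.
have lt_x := ltn_ord x; case: ifP => [_|ox]; first exact: leq_ltn_trans (leq_pred x) lt_x.
have : (x./2 < k)%N by rewrite ltn_half_double.
by rewrite -leq_double doubleS -{2}(odd_double_half x) ox.
Qed.

Definition flip x : 'I_k.*2 := Ordinal (flip_subproof x).

Lemma odd_flip x : odd (flip x) = ~~ odd x.
Proof.
rewrite /=; case: ifP => ox /=; last by rewrite ox.
by case: (nat_of_ord x) ox => //= n /negbTE.
Qed.

Lemma half_flip x : half_ord (flip x) = half_ord x.
Proof.
apply: ord_inj => /=; case: ifP => ox; last by rewrite /= uphalf_half ox.
case: (nat_of_ord x) ox => //= n on.
by rewrite uphalf_half (negbTE on).
Qed.

Lemma half_ord_inj x y : half_ord x = half_ord y -> odd x = odd y -> x = y.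
Proof.
move=> /(congr1 val) /= h o; apply: ord_inj.
by rewrite -(odd_double_half x) h o odd_double_half.
Qed.

Lemma flipK : involutive flip.
Proof. by move=> x; apply: half_ord_inj; rewrite ?half_flip // !odd_flip negbK. Qed.

Lemma flip_neq x : flip x != x.
Proof.
apply/eqP => /(congr1 (fun z : 'I_k.*2 => odd z)); rewrite odd_flip.
by case: (odd x).
Qed.

Lemma base_diagram_subproof : is_chord_diagram [set [set x; flip x] | x : 'I_k.*2].
Proof.
have mem_pair x y : (y \in [set x; flip x]) -> [set x; flip x] = [set y; flip y].
  by rewrite !inE => /orP[] /eqP-> //; rewrite flipK setUC.
apply/andP; split; last first.
  by apply/forall_inP => _ /imsetP[x _ ->]; rewrite cards2 [x == _]eq_sym flip_neq.
apply/and3P; split.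
- rewrite eqEsubset subsetT; apply/subsetP => x _.
  by apply/bigcupP; exists [set x; flip x]; rewrite ?set21 //; apply/imsetP; exists x.
- apply/trivIsetP => _ _ /imsetP[x _ ->] /imsetP[y _ ->] nxy.
  rewrite -setI_eq0; apply: contraNT nxy => /set0Pn[z /setIP[zx zy]].
  by rewrite (mem_pair x z) // (mem_pair y z).
- by apply/imsetP => -[x _ /setP/(_ x)]; rewrite in_set0 set21.
Qed.

Definition base_diagram := ChordDiagram base_diagram_subproof.

Lemma partner_base x : partner base_diagram x = flip x.
Proof. by apply/esym/eqP; rewrite -mem_chord; apply/imsetP; exists x. Qed.

End Flip.

Lemma reshape_index_cons n s i : reshape_index (n :: s) i =
  if (i < n)%N then 0%N else (reshape_index s (i - n)).+1.
Proof.
rewrite /reshape_index /= subn_eq0; case: ltnP => //= le_ni.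
by rewrite subSn.
Qed.

Lemma reshape_offset_cons n s i : reshape_offset (n :: s) i =
  if (i < n)%N then i else reshape_offset s (i - n).
Proof.
rewrite /reshape_offset reshape_index_cons; case: ltnP => _ /=; first by rewrite subn0.
by rewrite subnDA.
Qed.

(** Doubling the rows cuts box [i] into the horizontal neighbours [2i] and [2i + 1]; the chords of
    the base diagram thus become dominoes within the rows. *)
Lemma reshape_double (s : seq nat) i (b : bool) :
  reshape_index (map double s) (b + i.*2) = reshape_index s i /\
  reshape_offset (map double s) (b + i.*2) = (b + (reshape_offset s i).*2)%N.
Proof.
elim: s i => [|n s IHs] i.
  by rewrite /reshape_index /reshape_offset /= !subn0.
rewrite /= !reshape_index_cons !reshape_offset_cons.
have -> : (b + i.*2 < n.*2)%N = (i < n)%N.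
  by rewrite -ltn_half_double (half_bit_double i b).
case: ltnP => // le_ni; have <- : (b + (i - n).*2)%N = (b + i.*2 - n.*2)%N.
  by rewrite doubleB addnBA // leq_double.
by have [-> ->] := IHs (i - n)%N.
Qed.

Section DoubledBoxes.
Variables (k : nat) (l : young k).
Implicit Types x : 'I_k.*2.

Lemma box_row_double x : box_row (young_double l) x = box_row l (half_ord x).
Proof.
rewrite /box_row -{1}(odd_double_half x).
by have [-> _] := reshape_double l x./2 (odd x).
Qed.

Lemma box_col_double x :
  box_col (young_double l) x = (odd x + (box_col l (half_ord x)).*2)%N.
Proof.
rewrite /box_col -{1}(odd_double_half x).
by have [_ ->] := reshape_double l x./2 (odd x).
Qed.

Lemma odd_box_col_double x : odd (box_col (young_double l) x) = odd x.
Proof. by rewrite box_col_double oddD odd_double addbF oddb. Qed.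

Lemma box_row_flip x : box_row (young_double l) (flip x) = box_row (young_double l) x.
Proof. by rewrite !box_row_double half_flip. Qed.

(** The column of a vertex determines its parity, so [q] preserves the even and the odd vertices. It
    acts on the odd ones as the conjugate by [flip] of its action on the even ones, hence is a
    product of two permutations of equal sign. *)
Lemma col_stabilizer_flip_even (q : 'S_k.*2) :
  q \in col_stabilizer (young_double l) -> (forall x, q (flip x) = flip (q x)) ->
  odd_perm q = false.
Proof.
move=> /col_stabilizerP Cq qflip.
have odd_q x : odd (q x) = odd x by rewrite -odd_box_col_double Cq odd_box_col_double.
pose f x := if odd x then x else q x.
have injf : injective f.
  move=> x y; rewrite /f; case: ifP => ox; case: ifP => oy // e; last exact: perm_inj e.
    by move: oy; rewrite -odd_q -e ox.
  by move: ox; rewrite -odd_q e oy.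
pose t := perm (inv_inj (@flipK k)).
have -> : q = (perm injf * perm injf ^ t)%g.
  apply/permP => x; rewrite permM [RHS](_ : _ = flip (f (flip (f x)))); last first.
    rewrite -{1}(flipK (perm injf x)).
    by rewrite -[X in (_ ^ t)%g X](permE (inv_inj (@flipK k))) permJ !permE.
  rewrite {2}/f; case: ifP => ox; rewrite /f odd_flip ?odd_q ox /= ?flipK //.
  by rewrite qflip flipK.
by rewrite odd_permM odd_permJ addbb.
Qed.

End DoubledBoxes.

Lemma row_sym_tr n (l : young n) d (r : mx_representation rat [set: 'S_n] d) :
  (forall s : 'S_n, (r s)^T = r s^-1%g) -> (row_sym r l)^T = row_sym r l.
Proof.
move=> rT; rewrite /row_sym linear_sum /= [RHS](reindex_inj invg_inj) /=.
by apply: eq_big => s; rewrite ?groupV ?rT.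

Qed.

Lemma col_sym_tr n (l : young n) d (r : mx_representation rat [set: 'S_n] d) :
  (forall s : 'S_n, (r s)^T = r s^-1%g) -> (col_sym r l)^T = col_sym r l.
Proof.
move=> rT; rewrite /col_sym linear_sum /= [RHS](reindex_inj invg_inj) /=.
by apply: eq_big => s; rewrite ?groupV // => _; rewrite linearZ /= rT odd_permV.
Qed.

(** * Coordinates in the basis of chord diagrams *)

Section ChordVectors.
Variable k : nat.
Implicit Types (C D : chord_diagram k) (s : 'S_k.*2) (l : young k) (v : QD k).

Local Notation rG := (chord_repr k).

Definition chord_vec C : QD k := delta_mx 0 (enum_rank C).

Lemma chord_vecE C D : chord_vec C 0 (enum_rank D) = (C == D)%:R.
Proof. by rewrite mxE /= (inj_eq enum_rank_inj) eq_sym. Qed.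

Lemma chord_vec_repr C s : chord_vec C *m rG s = chord_vec (chord_diagram_act C s).
Proof.
apply/rowP => j; rewrite -rowE !mxE enum_rankK /= -{2}[j]enum_valK.
by rewrite (inj_eq enum_rank_inj).
Qed.

Lemma chord_repr_coord v s D :
  (v *m rG s) 0 (enum_rank D) = v 0 (enum_rank (chord_diagram_act D s^-1%g)).
Proof.
rewrite mxE (bigD1 (enum_rank (chord_diagram_act D s^-1%g))) //= !mxE !enum_rankK.
rewrite chord_diagram_actKV eqxx mulr1 big1 ?addr0 // => i ni; rewrite !mxE enum_rankK.
case: eqP => [eD|]; last by rewrite mulr0.
by rewrite eD chord_diagram_actK enum_valK eqxx in ni.
Qed.

Lemma chord_repr_tr s : (rG s)^T = rG s^-1%g.
Proof.
apply/matrixP => i j; rewrite !mxE; congr (_ : bool)%:R.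
apply/eqP/eqP => ->; by rewrite ?chord_diagram_actK ?chord_diagram_actKV.
Qed.

(** The coefficient is the signed count of the pairs [(p, q)] for which [q * p] fixes the base
    diagram. All signs are positive, and the identity pair occurs. *)
Lemma base_young_sym_gt0 l :
  0 < (chord_vec (base_diagram k) *m young_sym rG (young_double l)) 0
        (enum_rank (base_diagram k)).
Proof.
set C0 := base_diagram k; set L := young_double l.
have coord p q : (chord_vec C0 *m rG (q * p)%g) 0 (enum_rank C0) =
    (chord_diagram_act C0 (q * p)%g == C0)%:R by rewrite chord_vec_repr chord_vecE.
(* The image of [C0] under [q] is also its image under the inverse of [p]. The second description
   puts the partner of [q x] in the row of [q x], the first in the column of [flip x]. This is the
   box of [flip (q x)], so [q] commutes with [flip]. *)
have even_q p q : p \in row_stabilizer L -> q \in col_stabilizer L ->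
    chord_diagram_act C0 (q * p)%g = C0 -> odd_perm q = false.
  move=> Rp Cq e; apply: (col_stabilizer_flip_even Cq) => x.
  have Rp' : (p^-1)%g \in row_stabilizer L by rewrite groupV.
  have eD : chord_diagram_act C0 q = chord_diagram_act C0 p^-1%g.
    by rewrite -{2}e chord_diagram_actM chord_diagram_actK.
  have := partner_act C0 q x; rewrite partner_base => <-.
  set y := q x; set z := partner _ y.
  have rz : box_row L z = box_row L y.
    rewrite /z eD -{1}[y](permKV p^-1%g) partner_act partner_base.
    by rewrite (row_stabilizerP _ _ Rp') box_row_flip -{2}[y](permKV p^-1%g)
      (row_stabilizerP _ _ Rp').
  have cz : box_col L z = box_col L (flip x).
    by rewrite /z /y partner_act partner_base (col_stabilizerP _ _ Cq).
  have cy : box_col L y = box_col L x by rewrite (col_stabilizerP _ _ Cq).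
  apply: (@box_inj _ L); first by rewrite rz box_row_flip.
  rewrite cz; move: cy; rewrite !box_col_double half_flip !odd_flip => cy.
  have oy : odd y = odd x by rewrite -!(odd_box_col_double l) !box_col_double cy.
  by move: cy; rewrite oy half_flip => /addnI ->.
have sgn p q : p \in row_stabilizer L -> q \in col_stabilizer L ->
    ((-1) ^+ odd_perm q *: (chord_vec C0 *m rG (q * p)%g)) 0 (enum_rank C0) =
    (chord_diagram_act C0 (q * p)%g == C0)%:R.
  move=> Rp Cq; rewrite mxE coord; case: eqP => [e|]; last by rewrite mulr0.
  by rewrite (even_q p q Rp Cq e) mulr1.
rewrite young_symE mulmx_sumr summxE (bigD1 1%g) ?group1 //= mulmx_sumr summxE.
rewrite (bigD1 1%g) ?group1 //= -addrA ltr_pwDl //.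
  by rewrite -scalemxAr sgn ?group1 // mulg1 chord_diagram_act1 eqxx ltr01.
have ge0 p : p \in row_stabilizer L -> forall P : pred 'S_k.*2,
    0 <= \sum_(q in col_stabilizer L | P q)
     (chord_vec C0 *m ((-1) ^+ odd_perm q *: rG (q * p)%g)) 0 (enum_rank C0).
  by move=> Rp P; apply: sumr_ge0 => q /andP[Cq _]; rewrite -scalemxAr sgn // ler0n.
rewrite addr_ge0 ?ge0 ?group1 // sumr_ge0 // => p /andP[Rp _].
rewrite mulmx_sumr summxE; have := ge0 p Rp predT.
by under eq_bigl do rewrite andbT.
Qed.

Lemma mulmx_tr_eq0 d (u : 'rV[rat]_d) : u *m u^T = 0 -> u = 0.
Proof.
move=> /matrixP/(_ 0 0); rewrite !mxE => /eqP; rewrite psumr_eq0 => [/allP h|i _].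
  apply/rowP => i; have := h i (mem_index_enum i); rewrite !mxE /= -expr2 sqrf_eq0.
  by move/eqP.
by rewrite !mxE -expr2 sqr_ge0.
Qed.

End ChordVectors.

Lemma row_sym_sqr n (l : young n) d (r : mx_representation rat [set: 'S_n] d) :
  row_sym r l *m row_sym r l = #|row_stabilizer l|%:R *: row_sym r l.
Proof.
rewrite {1}/row_sym mulmx_suml (eq_bigr _ (fun p Rp => mul_row_sym r Rp)).
by rewrite sumr_const scaler_nat.
Qed.

Lemma col_sym_sqr n (l : young n) d (r : mx_representation rat [set: 'S_n] d) :
  col_sym r l *m col_sym r l = #|col_stabilizer l|%:R *: col_sym r l.
Proof.
rewrite {1}/col_sym mulmx_suml (eq_bigr (fun=> col_sym r l)).
  by rewrite sumr_const scaler_nat.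
move=> q Cq; rewrite -scalemxAl mul_col_sym // scalerA -signr_addb addbb.
by rewrite scale1r.
Qed.

(** Row and column sums are symmetric and proportional to their squares. Since the dot product is
    definite over the rationals, [w B A B A = 0] gives [w B A B = 0], and this gives [w B A = 0]. *)
Lemma young_sym_sqr_neq0 n (l : young n) d (r : mx_representation rat [set: 'S_n] d)
    (w : 'rV[rat]_d) :
  (forall s : 'S_n, (r s)^T = r s^-1%g) -> w *m young_sym r l != 0 ->
  w *m young_sym r l *m young_sym r l != 0.
Proof.
move=> rT; apply: contraNneq; rewrite /young_sym !mulmxA.
set A := row_sym r l; set B := col_sym r l => z.
have AT : A^T = A by apply: row_sym_tr.
have BT : B^T = B by apply: col_sym_tr.
have BB := col_sym_sqr l r; have AA := row_sym_sqr l r.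
have z1 : w *m B *m A *m B = 0.
  apply: mulmx_tr_eq0; rewrite !trmx_mul AT BT !mulmxA -(mulmxA _ B B) BB.
  by rewrite -scalemxAr -!scalemxAl z !mul0mx scaler0.
apply/eqP/mulmx_tr_eq0; rewrite !trmx_mul AT BT !mulmxA -(mulmxA _ A A) AA.
by rewrite -scalemxAr -!scalemxAl z1 !mul0mx scaler0.
Qed.

(** * The eigenvalue *)

Lemma prod_boxes n (l : young n) (F : nat -> nat -> rat) :
  \prod_(i < n) F (box_row l i) (box_col l i) =
  \prod_(t < size l) \prod_(s < nth 0%N l t) F t s.
Proof.
have row_lt i : (box_row l i < size l)%N by exact/reshape_indexP/ltn_sumn_young.
rewrite (partition_big (fun i => Ordinal (row_lt i)) xpredT) //=.
apply: eq_bigr => t _.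
have injb : {in xpredT &, injective (@box_at n l t)}.
  by move=> c d _ _ /(congr1 (box_col l)); rewrite !box_col_at => /ord_inj.
transitivity (\prod_(i in [set @box_at n l t c | c in xpredT]) F t (box_col l i)).
  apply: eq_big => [i|i /eqP <- //]; apply/eqP/imsetP => [<-|[c _ ->]].
    exists (Ordinal (ltn_box_col l i)) => //; apply: (@box_inj _ l).
      by rewrite box_row_at.
    by rewrite box_col_at.
  by apply: ord_inj; rewrite /= box_row_at.
by rewrite big_imset //; apply: eq_bigr => s _; rewrite box_col_at.
Qed.

Section EvenVertices.
Variable k : nat.
Implicit Types (C D : chord_diagram k) (x y z i : 'I_k.*2) (j : 'I_k).

Local Notation rG := (chord_repr k).
Local Notation C0 := (base_diagram k).

Lemma even_ord_subproof j : (j.*2 < k.*2)%N.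
Proof. by rewrite ltn_double. Qed.

Definition even_ord j : 'I_k.*2 := Ordinal (even_ord_subproof j).

Lemma half_even_ord j : half_ord (even_ord j) = j.
Proof. by apply: ord_inj; rewrite /= doubleK. Qed.

Lemma odd_even_ord j : odd (even_ord j) = false.
Proof. exact: odd_double. Qed.

Lemma half_ordP j x : half_ord x = j -> x = even_ord j \/ x = flip (even_ord j).
Proof.
move=> h; case: (boolP (odd x)) => ox; [right|left]; apply: half_ord_inj.
- by rewrite half_flip half_even_ord.
- by rewrite odd_flip odd_even_ord ox.
- by rewrite half_even_ord.
- by rewrite odd_even_ord (negPf ox).
Qed.

(** The diagrams that are arbitrary on the first [2m] vertices and equal to the base diagram beyond;
    they index the induction that adds one chord at a time. *)
Definition agree_from m D :=
  [forall z : 'I_k.*2, (m <= half_ord z)%N ==> (partner D z == flip z)].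

Lemma agree_fromP m D :
  reflect (forall z, (m <= half_ord z)%N -> partner D z = flip z) (agree_from m D).
Proof.
apply: (iffP forallP) => h z; first by move: (h z) => /implyP hz /hz/eqP.
by apply/implyP => /h ->.
Qed.

Lemma partner_agree_leq j D :
  agree_from j.+1 D -> (partner D (flip (even_ord j)) <= even_ord j)%N.
Proof.
move=> /agree_fromP agD; set w := partner D _.
have Dw : partner D w = flip (even_ord j) by rewrite partnerK.
have [lt_w|lt_w|e] := ltngtP (half_ord w) j.
- by apply: ltnW; rewrite /= -ltn_half_double.
- have := half_flip w; rewrite -(agD _ lt_w) Dw half_flip half_even_ord => e.
  by rewrite -e ltnn in lt_w.
have [->//|ew] := half_ordP (ord_inj e).
by have := partner_neq D (flip (even_ord j)); rewrite -/w ew eqxx.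
Qed.

(** When [i] is the partner of [2j + 1], exchanging [i] and [2j] restores the base chord. A diagram
    agreeing from [j + 1] is therefore one agreeing from [j] with a choice of [i <= 2j]. *)
Lemma agree_from_tperm j i D (t := tperm i (even_ord j)) : (i <= even_ord j)%N ->
  agree_from j.+1 (chord_diagram_act D t) &&
    (partner (chord_diagram_act D t) (flip (even_ord j)) == i) = agree_from j D.
Proof.
set x := even_ord j; set y := flip x => le_ix.
have hx : half_ord x = j := half_even_ord j.
have hy : half_ord y = j by rewrite half_flip.
have hi : (half_ord i <= j)%N by rewrite /= -[leqRHS](doubleK j) half_leq.
have nyx : y != x := flip_neq x.
have nyi : y != i.
  apply: contraTneq le_ix => <-; rewrite -ltnNge /y /= odd_double.
  exact: ltnSn.
have ty : t y = y by rewrite tpermD // eq_sym.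
have tz z : (j < half_ord z)%N -> t z = z.
  move=> lt_z; rewrite tpermD //; apply: contraTneq lt_z => <-; rewrite -leqNgt //.
  by rewrite hx.
apply/andP/agree_fromP => [[/agree_fromP agD /eqP ei] z|agD].
  have Dy : partner D y = x.
    by apply: (@perm_inj _ t); rewrite -partner_act ty ei /t tpermR.
  rewrite leq_eqVlt => /orP[/eqP e|lt_z].
    have [->|->] := half_ordP (ord_inj (esym e)); rewrite -/x -/y.
      by rewrite -Dy partnerK.
    by rewrite Dy flipK.
  apply: (@perm_inj _ t); rewrite -partner_act (tz z lt_z) (agD z lt_z).
  by rewrite tz // half_flip.
split; last by rewrite -ty partner_act agD ?hy // /y flipK /t tpermR.
apply/agree_fromP => z lt_z.
by rewrite -{1}(tz z lt_z) partner_act agD ?(ltnW lt_z) // tz // half_flip.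
Qed.

Lemma sum_agree_from j (F : chord_diagram k -> rat) :
  \sum_(D | agree_from j.+1 D) F D =
  \sum_(D | agree_from j D) \sum_(i : 'I_k.*2 | (i <= even_ord j)%N)
    F (chord_diagram_act D (tperm i (even_ord j))).
Proof.
rewrite exchange_big /= (partition_big (fun D => partner D (flip (even_ord j)))
  (fun i : 'I_k.*2 => i <= even_ord j)%N) /=; last exact: partner_agree_leq.
apply: eq_bigr => i le_i.
rewrite (reindex_inj (can_inj (@chord_diagram_actK k (tperm i (even_ord j))))) /=.
by apply: eq_bigl => D; rewrite agree_from_tperm.
Qed.

Lemma card_unions_base : #|unions C0 C0| = (2 ^ k)%N.
Proof.
rewrite -[in RHS](card_ord k) -cardsT -card_powerset.
pose f (B : {set 'I_k}) := [set x | half_ord x \in B].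
have injf : injective f.
  move=> A B /setP e; apply/setP => j; have := e (even_ord j).
  by rewrite !inE half_even_ord.
rewrite -(card_imset _ injf); apply: eq_card => A.
apply/unionsP/imsetP => [h|[B _ ->] x]; last by rewrite !partner_base !inE half_flip.
exists [set j | even_ord j \in A]; first by rewrite powersetE subsetT.
apply/setP => x; rewrite !inE.
have [e|e] := half_ordP (erefl (half_ord x)); first by rewrite -e.
by rewrite {1}e; have [] := h (even_ord (half_ord x)); rewrite partner_base.
Qed.

Lemma union_components_base : union_components C0 C0 = k.
Proof. by apply: (@expnI 2) => //; rewrite -card_unions card_unions_base. Qed.

Lemma union_components_base_leq D : (union_components C0 D <= k)%N.
Proof.
rewrite -(@leq_exp2l 2) // -card_unions -card_unions_base.
apply/subset_leq_card/subsetP => A /unionsP h; apply/unionsP => x.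
by have [-> _] := h x.
Qed.

Lemma agree_from0 D : agree_from 0 D = (D == C0).
Proof.
apply/agree_fromP/eqP => [h|-> z _]; last exact: partner_base.
by apply: eq_partner => x; rewrite h // partner_base.
Qed.

Lemma agree_from_k D : agree_from k D.
Proof. by apply/agree_fromP => z; rewrite leqNgt ltn_ord. Qed.

Section Eigenvector.
Variables (q : rat) (v : QD k) (c : 'I_k -> rat).
Hypothesis q_neq0 : q != 0.
Hypothesis jm_v : forall j, v *m jucys_murphy rG (even_ord j) = c j *: v.

Local Notation "v_[ D ]" := (v 0 (enum_rank D)).

(** The Jucys-Murphy product formula, read at the coordinate [C0] of [v]. The power [k - m] accounts
    for the base chords not yet released, each a component by itself. *)
Lemma sum_union_components_agree m : (m <= k)%N ->
  q ^+ (k - m) * \prod_(j < k | (j < m)%N) (q + c j) * v_[C0] =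
  \sum_(D | agree_from m D) q ^+ union_components C0 D * v_[D].
Proof.
elim: m => [|m IHm] lt_m.
  rewrite (eq_bigl _ _ agree_from0) big_pred1_eq big_pred0 // mulr1 subn0.
  by rewrite union_components_base.
pose j := Ordinal lt_m; have := IHm (ltnW lt_m); set S := \sum_(D | _) _ => IH.
(* The extra factor [q] compensates for the component lost in a merger. *)
apply: (mulfI q_neq0); rewrite !mulrA -exprS -subSn // subSS.
rewrite (bigD1 j) //= (eq_bigl (fun i : 'I_k => i < m)%N); last first.
  by move=> i; rewrite ltnS [in RHS]ltn_neqAle andbC.
rewrite [_ * (_ * _)]mulrCA -mulrA IH /S big_distrr /=.
rewrite (sum_agree_from j) big_distrr /=; apply: eq_bigr => D /agree_fromP agD.
have Jv : c j * v_[D] = \sum_(i : 'I_k.*2 | (i < even_ord j)%N)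
    v_[chord_diagram_act D (tperm i (even_ord j))].
  transitivity ((v *m jucys_murphy rG (even_ord j)) 0 (enum_rank D)).
    by rewrite jm_v mxE.
  rewrite mulmx_sumr summxE; apply: eq_bigr => i _.
  by rewrite chord_repr_coord tpermV.
(* The index [i = 2j] leaves [D] unchanged and accounts for the summand [q]. Each smaller [i] merges
   two components, and together these account for [c j]. *)
rewrite (bigD1 (even_ord j)) //= tperm1 chord_diagram_act1 mulrDr.
rewrite mulrCA mulrDl Jv mulrDr; congr (_ + _); first by rewrite mulrCA.
rewrite !big_distrr /=; apply: eq_big => [i|i lt_i].
  by rewrite [in LHS]ltn_neqAle andbC.
rewrite mulrA -exprS union_components_tperm //.
- by rewrite partner_base agD // half_even_ord.
- by apply: contraTneq lt_i => ->; rewrite ltnn.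
by apply: contraTneq lt_i => ->; rewrite partner_base -leqNgt /= odd_double.
Qed.

Lemma sum_union_components :
  \prod_(j < k) (q + c j) * v_[C0] = \sum_D q ^+ union_components C0 D * v_[D].
Proof.
have := sum_union_components_agree (leqnn k); rewrite subnn mul1r => e.
rewrite (eq_bigl (fun j : 'I_k => j < k)%N) => [|j]; last by rewrite ltn_ord.
by rewrite e; apply: eq_bigl => D; rewrite agree_from_k.
Qed.

End Eigenvector.

Lemma intersection_eigenvalue g (v : QD k) (c : 'I_k -> rat) mu : (0 < g)%N ->
  (forall j, v *m jucys_murphy rG (even_ord j) = c j *: v) ->
  v 0 (enum_rank C0) != 0 -> v *m intersection_mx g k = mu *: v ->
  mu = \prod_(j < k) (2 * g%:R - c j).
Proof.
move=> g0 jm_v nz Mv; apply: (mulIf nz).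
have q0 : - (2 * g%:R) != 0 :> rat by rewrite oppr_eq0 mulf_neq0 // pnatr_eq0 -?lt0n.
have -> : mu * v 0 (enum_rank C0) = (v *m intersection_mx g k) 0 (enum_rank C0).
  by rewrite Mv mxE.
rewrite mxE (reindex (@enum_rank _)) /=; last exact/onW_bij/enum_rank_bij.
have -> : \prod_(j < k) (2 * g%:R - c j) =
    (-1) ^+ k * \prod_(j < k) (- (2 * g%:R) + c j).
  rewrite -[X in _ ^+ X]card_ord -prodrN; apply: eq_bigr => j _.
  by rewrite opprD opprK.
rewrite -mulrA (sum_union_components q0 jm_v) big_distrr /=.
apply: eq_bigr => D _; rewrite mxE !enum_rankK /pairing union_componentsC.
(* By this bound the exponent [k - r] is a true difference, so its sign factors. *)
have le_k := union_components_base_leq D.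
have signB (a r : nat) : (r <= a)%N -> (-1) ^+ (a - r) = (-1) ^+ a * (-1) ^+ r :> rat.
  move=> le_ra; rewrite -{2}(subnK le_ra) exprD -mulrA -exprD addnn.
  by rewrite -[X in _ * X]signr_odd odd_double mulr1.
by rewrite signB // [(- (2 * _)) ^+ _]exprNn mulrC !mulrA.
Qed.

(** Vertex [2j] is the left half of box [j]: if that box is [(t, s)], the content is [2s - t]. *)
Lemma chord_eigenvalueE g (l : young k) : chord_eigenvalue g l =
  \prod_(j < k) (2 * g%:R - ((box_col (young_double l) (even_ord j))%:R
                             - (box_row (young_double l) (even_ord j))%:R)).
Proof.
pose F t s : rat := 2 * g%:R - 2 * s%:R + t%:R.
rewrite /chord_eigenvalue -(prod_boxes l F); apply: eq_bigr => j _.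
rewrite box_row_double box_col_double odd_even_ord half_even_ord /F add0n.
by rewrite opprB -mul2n natrM addrA addrAC.
Qed.

(** If the first row is longer than [g], its box in column [g] contributes the factor zero.
    Otherwise [s < g] for every box, and all factors are nonnegative. *)
Lemma chord_eigenvalue_ge0 g (l : young k) : 0 <= chord_eigenvalue g l.
Proof.
rewrite /chord_eigenvalue.
have [lt_g|le_g] := ltnP g (nth 0%N l 0); last first.
  apply: prodr_ge0 => t _; apply: prodr_ge0 => s _.
  apply: addr_ge0 => //; rewrite -mulrBr mulr_ge0 // subr_ge0 ler_nat.
  apply: leq_trans (ltnW (ltn_ord s)) _; apply: leq_trans le_g.
  exact: nth_young_leq.
have l0 : (0 < size l)%N by case: (rows l) lt_g.
by rewrite (bigD1 (Ordinal l0)) //= (bigD1 (Ordinal lt_g)) //= subrr addr0 !mul0r.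
Qed.

End EvenVertices.

(** * Orbits of pairs of diagrams *)

Section Blocks.
Variables (k : nat) (C D : chord_diagram k).
Implicit Types (x y z : 'I_k.*2) (xs : seq 'I_k.*2).

Definition rotation x := partner D (partner C x).
Local Notation pi := rotation.

Lemma rotation_inj : injective pi.
Proof. by move=> x y /partner_inj/partner_inj. Qed.

Lemma partner_rotation x : partner D (pi x) = partner C x.
Proof. exact: partnerK. Qed.

Lemma rotation_partner x : pi (partner C (pi x)) = partner C x.
Proof. by rewrite /rotation !partnerK. Qed.

(** An equality for [i] at [x] yields one for [i - 2] at [pi x]; the cases [0] and [1] would be
    fixed points of [partner C] and [partner D]. Hence a cycle of [C + D] consists of two disjoint
    rotation orbits, exchanged by [partner C]. *)
Lemma partner_neq_iter i x : partner C x <> iter i pi x.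
Proof.
have [m] := ubnP i; elim: m => // m IHm in i x *.
case: i => [|[|i]] lt_i e; first by case/eqP: (partner_neq C x).
  by case/eqP: (partner_neq D (partner C x)); apply: esym e.
apply: (IHm i (pi x)); first by rewrite ltnW // -ltnS ltnW.
by apply: rotation_inj; rewrite rotation_partner e iterSr.
Qed.

Lemma partner_notin_orbit x y :
  fconnect pi x y -> fconnect pi x (partner C y) = false.
Proof.
move=> xy; apply/negP => xpy.
have : fconnect pi y (partner C y).
  by apply: connect_trans xpy; rewrite fconnect_sym //; apply: rotation_inj.
by move/iter_findex/esym; apply: partner_neq_iter.
Qed.

Definition block x := fingraph.orbit pi x ++ map (partner C) (fingraph.orbit pi x).

Lemma mem_block x y :
  (y \in block x) = fconnect pi x y || fconnect pi x (partner C y).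
Proof.
rewrite mem_cat -fconnect_orbit; congr (_ || _).
apply/mapP/idP => [[z]|xy]; first by rewrite -fconnect_orbit => xz ->; rewrite partnerK.
by exists (partner C y); rewrite ?partnerK // -fconnect_orbit.
Qed.

Lemma block_uniq x : uniq (block x).
Proof.
rewrite cat_uniq orbit_uniq (map_inj_uniq (@partner_inj k C)) orbit_uniq andbT /=.
apply/hasPn => y /mapP[z]; rewrite -!fconnect_orbit => xz ->.
by rewrite partner_notin_orbit.
Qed.

Lemma fconnect_rotation x y : fconnect pi x (pi y) = fconnect pi x y.
Proof.
apply/idP/idP => [xpy|xy]; last exact: connect_trans xy (fconnect1 _ _).
apply: connect_trans xpy _; rewrite fconnect_sym; last exact: rotation_inj.
exact: fconnect1.
Qed.

Lemma mem_block_partner x y :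
  ((partner C y \in block x) = (y \in block x)) *
  ((partner D y \in block x) = (y \in block x)).
Proof.
split; rewrite !mem_block ?partnerK; first exact: orbC.
rewrite -{1}[y](partnerK C) fconnect_rotation orbC; congr (_ || _).
by rewrite -fconnect_rotation /rotation !partnerK.
Qed.

Lemma block_decomposition (A : {set 'I_k.*2}) :
  (forall x, ((partner C x \in A) = (x \in A)) * ((partner D x \in A) = (x \in A))) ->
  exists xs, uniq (flatten (map block xs)) /\ flatten (map block xs) =i A.
Proof.
have [m] := ubnP #|A|; elim: m => // m IHm in A * => lt_A clA.
have [->|[x Ax]] := set_0Vmem A.
  by exists [::]; split=> // x; rewrite inE.
have xx : x \in block x by rewrite mem_block connect0.
have [||xs [uxs exs]] := IHm (A :\: [set y in block x]).
- rewrite ltnS in lt_A; apply: leq_trans lt_A; apply/proper_card/properP.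
  by split; [exact: subsetDl | exists x; rewrite // !inE xx].
- by move=> y; rewrite !inE !mem_block_partner !clA.
have clAi z i : z \in A -> iter i pi z \in A.
  by move=> Az; elim: i => //= i; rewrite /rotation !clA.
have clAc z : fconnect pi x z -> z \in A by move/iter_findex <-; apply: clAi.
exists (x :: xs); split=> [|y] /=.
  rewrite cat_uniq block_uniq uxs andbT; apply/hasPn => y.
  by rewrite exs !inE => /andP[].
rewrite mem_cat exs !inE; case: (boolP (y \in block x)) => //=.
rewrite mem_block => /orP[/clAc-> //|/clAc]; by rewrite clA.
Qed.

Lemma block_seq_exists : exists xs : seq 'I_k.*2,
  perm_eq (flatten (map block xs)) (enum 'I_k.*2) &&
  is_young k (map (fingraph.order pi) xs).
Proof.
have [|xs [uxs exs]] := @block_decomposition [set: 'I_k.*2].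
  by move=> x; rewrite !inE.
pose r := relpre (fingraph.order pi) geq.
have geq_total : total r by move=> x y; apply: leq_total.
exists (sort r xs).
have pxs : perm_eq (flatten (map block (sort r xs))) (enum 'I_k.*2).
  apply: (@perm_trans _ (flatten (map block xs))).
    by apply/perm_flatten/perm_map; rewrite perm_sort.
  by apply: uniq_perm; rewrite ?enum_uniq // => x; rewrite exs mem_enum !inE.
rewrite pxs /=; apply/and3P; split.
- by rewrite sorted_map sort_sorted.
- by apply/mapP => -[x _ e]; have := fingraph.order_gt0 pi x; rewrite -e.
(* Each block has twice the size of its orbit, and together the blocks cover all [2k] vertices. *)
rewrite -(inj_eq double_inj); apply/eqP.
transitivity (size (enum 'I_k.*2)); last by rewrite size_enum_ord.
rewrite -(perm_size pxs) size_flatten /shape -map_comp.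
elim: (sort r xs) => //= x s IHs.
by rewrite doubleD IHs size_cat size_map size_orbit addnn.
Qed.

Definition block_seq := xchoose block_seq_exists.

Lemma block_seq_young : is_young k (map (fingraph.order pi) block_seq).
Proof. by have /andP[] := xchooseP block_seq_exists. Qed.

Definition cycle_type : young k := Young block_seq_young.

Lemma perm_block_seq : perm_eq (flatten (map block block_seq)) (enum 'I_k.*2).
Proof. by have /andP[] := xchooseP block_seq_exists. Qed.

(** One further turn around the orbit makes the exponent positive, so that [partner D] at [y] can be
    computed from the preceding iterate. *)
Lemma fconnect_iterS x y : fconnect pi x y -> exists i, y = iter i.+1 pi x.
Proof.
move=> xy; exists (findex pi x y + (fingraph.order pi x).-1)%N.
rewrite -addnS prednK ?fingraph.order_gt0 // iterD iter_order ?iter_findex //.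
exact: rotation_inj.
Qed.

End Blocks.

Section CycleType.
Variables (k : nat) (C D C' D' : chord_diagram k).

Local Notation pi := (rotation C D).
Local Notation pi' := (rotation C' D').

(** On each block, [f] sends the iterates of [x] to those of [x'] and is extended by [partner C].
    Equal orders make the iterates wrap around alike, and [f] then respects [partner D], which is
    [partner C] one rotation step back. *)
Lemma block_map (xs xs' : seq 'I_k.*2) :
  map (fingraph.order pi) xs = map (fingraph.order pi') xs' ->
  uniq (flatten (map (block C D) xs)) ->
  exists f, map f (flatten (map (block C D) xs)) = flatten (map (block C' D') xs')
    /\ {in flatten (map (block C D) xs), forall y,
         f (partner C y) = partner C' (f y) /\ f (partner D y) = partner D' (f y)}.
Proof.
elim: xs xs' => [|x xs IHxs] [|x' xs'] //=; first by exists id.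
case=> eo /IHxs{}IHxs; rewrite cat_uniq => /and3P[_ /hasPn disj /IHxs[f0 [f0M f0P]]].
pose f y := if fconnect pi x y then iter (findex pi x y) pi' x'
  else if fconnect pi x (partner C y)
    then partner C' (iter (findex pi x (partner C y)) pi' x') else f0 y.
have f_iter i : f (iter i pi x) = iter i pi' x'.
  have [m] := ubnP i; elim: m => // m IHm in i * => lt_im.
  have [lt_io|le_oi] := ltnP i (fingraph.order pi x).
    by rewrite /f fconnect_iter findex_iter.
  have iter_sub T (h : T -> T) z : iter (fingraph.order pi x) h z = z ->
      iter i h z = iter (i - fingraph.order pi x) h z.
    by move=> hz; rewrite -{1}(subnK le_oi) iterD hz.
  rewrite !iter_sub ?(iter_order (@rotation_inj k C D)) //; last first.
    by rewrite eo (iter_order (@rotation_inj k C' D')).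
  rewrite ltnS in lt_im; apply: IHm; apply: leq_trans lt_im.
  by rewrite ltn_subrL fingraph.order_gt0 (leq_trans (fingraph.order_gt0 _ _) le_oi).
have f_part y : fconnect pi x y -> f (partner C y) = partner C' (f y).
  by move=> xy; rewrite /f partner_notin_orbit // partnerK xy.
have f_out y : y \notin block C D x -> f y = f0 y.
  by rewrite mem_block negb_or /f => /andP[/negPf-> /negPf->].
clearbody f; exists f; split=> [|y].
  rewrite map_cat; congr (_ ++ _).
    have mo : map f (fingraph.orbit pi x) = fingraph.orbit pi' x'.
      apply: (@eq_from_nth _ x); rewrite size_map !size_orbit // => i lt_i.
      rewrite (nth_map x) ?size_orbit // [RHS](set_nth_default x') ?size_orbit -?eo //.
      by rewrite /fingraph.orbit -eo !nth_traject.
    rewrite map_cat /block -mo -!map_comp; congr (_ ++ _); apply/eq_in_map => y /=.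
    by rewrite -fconnect_orbit => /f_part.
  rewrite -f0M; apply/eq_in_map => y /disj; exact: f_out.
rewrite mem_cat; case: (boolP (y \in block C D x)) => [Bxy _|nBxy /= ys]; last first.
  have nBy : (partner C y \notin block C D x) * (partner D y \notin block C D x).
    by rewrite !mem_block_partner.
  by rewrite (f_out _ nBxy) (f_out _ nBy.1) (f_out _ nBy.2); exact: f0P y ys.
have f_partD z : fconnect pi x z -> f (partner D z) = partner D' (f z).
  move=> /fconnect_iterS[i ->]; rewrite f_iter !iterS !partner_rotation.
  by rewrite f_part ?fconnect_iter // f_iter.
have f_rot z : fconnect pi x z -> f (pi z) = pi' (f z).
  by move=> /fconnect_iterS[i ->]; rewrite -iterS !f_iter.
move: Bxy; rewrite mem_block => /orP[xy|xy].
  by rewrite f_part // f_partD.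
rewrite -[y](partnerK C); move: (partner C y) xy => z xz.
by rewrite partnerK f_part // partnerK; split=> //; apply: f_rot.
Qed.

Lemma cycle_type_conj : cycle_type C D = cycle_type C' D' ->
  exists g, chord_diagram_act C g = C' /\ chord_diagram_act D g = D'.
Proof.
move=> /(congr1 (@rows k)) /= e.
have pxs := perm_block_seq C D; have pxs' := perm_block_seq C' D'.
have uxs : uniq (flatten (map (block C D) (block_seq C D))).
  by rewrite (perm_uniq pxs) enum_uniq.
have [f [fM fP]] := block_map e uxs.
have all_in x : x \in flatten (map (block C D) (block_seq C D)).
  by rewrite (perm_mem pxs) mem_enum.
have injf : injective f.
  apply/injectiveP; rewrite /injectiveb /dinjectiveb.
  by rewrite -(perm_uniq (perm_map f pxs)) fM (perm_uniq pxs') enum_uniq.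
exists (perm injf); split; apply: eq_partner => y.
  rewrite -[y](permKV (perm injf)) partner_act; set z := ((perm injf)^-1 y)%g.
  by rewrite !permE; have [] := fP _ (all_in z).
rewrite -[y](permKV (perm injf)) partner_act; set z := ((perm injf)^-1 y)%g.
by rewrite !permE; have [] := fP _ (all_in z).
Qed.

End CycleType.

(** * The commutant *)

Section SimpleImage.
Variables (gT : finGroupType) (G : {group gT}) (F : fieldType) (n1 n2 : nat).
Variables (rG1 : mx_representation F G n1) (rG2 : mx_representation F G n2).
Variables (U : 'M[F]_n1) (V : 'M[F]_n2) (H : 'M[F]_(n1, n2)).

(** Schur's argument: the kernel of [H] meets [U] in a submodule, which is zero since [U] is simple
    and its image is not zero. *)
Lemma mxsimple_image_rsim (modU : mxmodule rG1 U) (modV : mxmodule rG2 V) :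
  {in G, forall x, rG1 x *m H = H *m rG2 x} ->
  mxsimple rG1 U -> (U *m H :=: V)%MS -> V != 0 ->
  mx_rsim (submod_repr modV) (submod_repr modU).
Proof.
move=> HJ [_ _ minU] defV nzV; apply: mx_rsim_sym.
have kerUH : (U :&: kermx H)%MS = 0.
  apply/eqP/contraT => nzK; case/eqP: nzV; apply/eqP; rewrite -submx0 -defV submx0.
  rewrite -sub_kermx; apply: submx_trans (capmxSr U (kermx H)).
  apply: minU => //; last exact: capmxSl.
  apply: capmx_module => //; apply/mxmoduleP => x Gx; apply/sub_kermxP.
  by rewrite -mulmxA HJ // mulmxA mulmx_ker mul0mx.
have sUHV : (val_submod (1%:M : 'M_(\rank U)) *m H <= V)%MS.
  by rewrite -defV submxMr // val_submodP.
have rk : \rank (U *m H) = \rank U by apply/mxrank_injP/eqP.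
exists (in_submod V (val_submod (1%:M : 'M_(\rank U)) *m H)).
- by rewrite -rk defV.
- rewrite /row_free mxrank_in_submod // -[X in _ == X]rk.
  by rewrite -(eqmxMr H (val_submod1 U)).
move=> x Gx; rewrite -in_submodJ // -mulmxA -HJ //.
have -> : val_submod 1%:M *m (rG1 x *m H) =
    submod_mx modU x *m (val_submod (1%:M : 'M_(\rank U)) *m H).
  rewrite (mulmxA (submod_mx _ _)) -val_submodE -(mul1mx (submod_mx _ _)).
  by rewrite val_submodJ // mulmxA.
by rewrite in_submodE [RHS]in_submodE; apply: mulmxA.
Qed.

End SimpleImage.

Section MaschkeProjection.
Variables (n d : nat) (rG : mx_representation rat [set: 'S_n] d).

Lemma invariant_projection (U : 'M[rat]_d) : mxmodule rG U ->
  exists P : 'M[rat]_d, [/\ forall x, rG x *m P = P *m rG x, (P <= U)%MS & U *m P = U].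
Proof.
move=> modU.
have [W modW defUW dxUW] := mx_Maschke_pchar rG (pchar_rat_pgroup _) modU (submx1 U).
have capUW := mxdirect_addsP dxUW.
exists (proj_mx U W); split.
- move=> x; have := proj_mx_hom capUW modU modW; rewrite defUW => /hom_mxP/(_ x).
  by rewrite inE !mul1mx => ->.
- by rewrite -[proj_mx U W]mul1mx proj_mx_sub.
by rewrite proj_mx_id.
Qed.

End MaschkeProjection.

Section Commutant.
Variable k : nat.
Implicit Types (C D : chord_diagram k) (s : 'S_k.*2) (l m : young k) (B : endQD k).

Local Notation rG := (chord_repr k).

Definition equivariant B := forall s, rG s *m B = B *m rG s.

Lemma chord_vec_mul C B j : (chord_vec C *m B) 0 j = B (enum_rank C) j.
Proof. by rewrite -rowE mxE. Qed.

Lemma equivariant_entry B C D s : equivariant B ->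
  B (enum_rank (chord_diagram_act C s)) (enum_rank (chord_diagram_act D s)) =
  B (enum_rank C) (enum_rank D).
Proof.
move=> eqB; rewrite -chord_vec_mul -chord_vec_repr -mulmxA eqB mulmxA.
by rewrite chord_repr_coord chord_diagram_actK chord_vec_mul.
Qed.

(** The entry of [B] at a chosen pair of type [l], with value 0 if no pair is found; for equivariant
    [B] the choice is immaterial. *)
Definition type_entry B l : rat :=
  if [pick p : chord_diagram k * chord_diagram k | cycle_type p.1 p.2 == l] is Some p
  then B (enum_rank p.1) (enum_rank p.2) else 0.

Lemma type_entry_is_linear l : linear_for *%R (type_entry^~ l).
Proof.
by move=> a A B; rewrite /type_entry; case: pickP => [p _|_]; rewrite ?mxE // mulr0 addr0.
Qed.

Lemma type_entry_inj B : equivariant B -> (forall l, type_entry B l = 0) -> B = 0.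
Proof.
move=> eqB B0; apply/matrixP => i j; rewrite mxE -[i]enum_valK -[j]enum_valK.
set C := enum_val i; set D := enum_val j.
have := B0 (cycle_type C D); rewrite /type_entry.
case: pickP => [[C' D'] /eqP /= e|/(_ (C, D))]; last by rewrite /= eqxx.
by have [s [<- <-]] := cycle_type_conj (esym e); rewrite equivariant_entry.
Qed.

Lemma equivariant_sum (w : young k -> rat) (P : young k -> endQD k) :
  (forall l, equivariant (P l)) -> equivariant (\sum_l w l *: P l).
Proof.
move=> comP s; rewrite mulmx_sumr mulmx_suml; apply: eq_bigr => l _.
by rewrite -scalemxAr -scalemxAl comP.
Qed.

Lemma type_entry_sum (w : young k -> rat) (P : young k -> endQD k) m :
  type_entry (\sum_l w l *: P l) m = \sum_l w l * type_entry (P l) m.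
Proof.
rewrite /type_entry; case: pickP => [p _|_].
  by rewrite summxE; apply: eq_bigr => l _; rewrite mxE.
by rewrite big1 // => l _; rewrite mulr0.
Qed.

(* The orbits of pairs of diagrams are indexed by Young diagrams, so that the
   commutant has dimension at most the number of these. *)
Lemma equivariant_span (P : young k -> endQD k) :
  (forall l, equivariant (P l)) ->
  (forall w, \sum_l w l *: P l = 0 -> forall l, w l = 0) ->
  forall B, equivariant B -> exists w, B = \sum_l w l *: P l.
Proof.
move=> comP indP B eqB.
pose V := \matrix_(i, j) type_entry (P (enum_val i)) (enum_val j) : 'M_#|{: young k}|.
have mulV (w : 'rV_#|{: young k}|) j : (w *m V) 0 j =
    type_entry (\sum_l w 0 (enum_rank l) *: P l) (enum_val j).
  rewrite type_entry_sum mxE (reindex (@enum_rank _)) /=;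
    last exact/onW_bij/enum_rank_bij.
  by apply: eq_bigr => l _; rewrite mxE enum_rankK.
(* A row vector killed by [V] gives a combination of the [P l] whose type entries all vanish. This
   combination is zero, and so are its coefficients by independence. *)
have uV : V \in unitmx.
  rewrite -row_free_unit -kermx_eq0; apply/eqP/row_matrixP => i; rewrite row0.
  set w := row i _; have wV : w *m V = 0 by rewrite -row_mul mulmx_ker row0.
  apply/rowP => j; rewrite [RHS]mxE -[j]enum_valK.
  apply: (indP (fun l => w 0 (enum_rank l))); apply: type_entry_inj => [|l].
    exact: equivariant_sum.
  by rewrite -[l]enum_rankK -mulV wV mxE.
pose b : 'rV_#|{: young k}| := \row_j type_entry B (enum_val j).
exists (fun l => (b *m invmx V) 0 (enum_rank l)).
set S := \sum_l _; have eqS : equivariant S by exact: equivariant_sum.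
apply/eqP; rewrite -subr_eq0; apply/eqP/type_entry_inj => [s|l].
  by rewrite mulmxBr mulmxBl eqB eqS.
have := type_entry_is_linear l (-1) S B.
rewrite scaleN1r mulN1r [- S + B]addrC => ->.
rewrite -[l]enum_rankK -mulV -mulmxA mulVmx // mulmx1 mxE.
by rewrite addNr.
Qed.

End Commutant.

(** * The decomposition *)

Section Decomposition.
Variable k : nat.
Implicit Types (l m : young k) (s : 'S_k.*2).

Local Notation rG := (chord_repr k).
Local Notation C0 := (base_diagram k).
Local Notation ysym l := (young_sym rG (young_double l)).

Definition eigen_vec l : QD k := chord_vec C0 *m ysym l.
Definition eigen_mx l : endQD k := cyclic_mx rG (eigen_vec l).

Lemma young_double_inj : injective (@young_double k).
Proof.
move=> l m /(congr1 (@rows _)) /= e; apply: val_inj.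
by apply: inj_map e; apply: double_inj.
Qed.

Lemma eigen_vec_entry_neq0 l : eigen_vec l 0 (enum_rank C0) != 0.
Proof. by rewrite gt_eqF // base_young_sym_gt0. Qed.

Lemma eigen_vec_neq0 l : eigen_vec l != 0.
Proof. by apply: contraNneq (eigen_vec_entry_neq0 l) => ->; rewrite mxE. Qed.

Lemma eigen_vec_young_sym l :
  exists2 a, a != 0 & eigen_vec l *m ysym l = a *: eigen_vec l.
Proof.
have [a ea] := cyclic_young_sym_line (cyclic_mx_id rG (eigen_vec l)).
exists a => //; apply/eqP => a0.
have := young_sym_sqr_neq0 (@chord_repr_tr k) (eigen_vec_neq0 l).
by rewrite -/(eigen_vec l) ea a0 scale0r eqxx.
Qed.

Lemma eigen_mx_module l : mxmodule rG (eigen_mx l).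
Proof. exact: cyclic_mx_module. Qed.

Lemma eigen_mx_simple l : mxsimple rG (eigen_mx l).
Proof.
by apply/cyclic_young_sym_simple/young_sym_sqr_neq0/eigen_vec_neq0/chord_repr_tr.
Qed.

(** The orbit map [H], which applies a group-ring element to [C0], is equivariant and sends the
    Young symmetrizer to [eigen_vec l]. It maps the simple Specht module onto [eigen_mx l]. *)
Lemma eigen_mx_specht l :
  mx_rsim (submod_repr (eigen_mx_module l)) (specht_repr (young_double l)).
Proof.
pose aG := regular_repr rat [set: 'S_k.*2]%G.
pose w := gring_row (1%:M : 'M[rat]_#|[set: 'S_k.*2]%G|).
have ysE : young_symmetrizer (young_double l) = w *m young_sym aG (young_double l).
  by rewrite /young_symmetrizer -young_symE -gring_row_mul mul1mx.
pose H := lin1_mx (mulmx (chord_vec C0) \o gring_mx rG).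
have HE u : u *m H = chord_vec C0 *m gring_mx rG u by rewrite mul_rV_lin1.
have HJ : {in [set: 'S_k.*2]%G, forall x, aG x *m H = H *m rG x}.
  move=> x Gx; apply/row_matrixP => i; rewrite !rowE !mulmxA !HE.
  by rewrite gring_mxJ // mulmxA.
have wH : young_symmetrizer (young_double l) *m H = eigen_vec l.
  rewrite HE /eigen_vec; congr (_ *m _).
  rewrite /young_symmetrizer -gring_opE young_symE linear_sum; apply: eq_bigr => p _.
  rewrite linear_sum; apply: eq_bigr => q _; rewrite linearZ /=.
  by rewrite gring_opG ?inE.
have specht_sub (u : 'rV_#|[set: 'S_k.*2]%G|) :
    (u <= specht_mx (young_double l))%MS -> (u *m H <= eigen_mx l)%MS.
  rewrite /specht_mx => uS; have [a ->] := cyclic_mx_sum uS.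
  rewrite mulmx_suml summx_sub // => x _.
  by rewrite -scalemxAl scalemx_sub // -mulmxA HJ ?inE // mulmxA wH cyclic_mx_repr.
have simS : mxsimple aG (specht_mx (young_double l)).
  rewrite /specht_mx ysE; apply: cyclic_young_sym_simple.
  (* The same scalar [e 1] governs the square of the symmetrizer in both representations. Its action
     on the nonzero [eigen_vec l] shows that it is not zero, whence the Specht module is simple. *)
  have [e eP] := young_sym_scalar (young_double l).
  have [a a0 ea] := eigen_vec_young_sym l.
  have e1 : e 1%g *: eigen_vec l = a *: eigen_vec l.
    rewrite -ea /eigen_vec -[RHS]mulmxA -{2}[ysym l]mulmx1 -(repr_mx1 rG) eP.
    by rewrite scalemxAr.
  have nze : e 1%g != 0.
    apply: contraNneq a0 => e0; move/eqP: e1; rewrite e0 scale0r eq_sym scaler_eq0.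
    by rewrite (negPf (eigen_vec_neq0 l)) orbF.
  rewrite -(mulmxA w) -{1}[young_sym aG _]mulmx1 -(repr_mx1 aG) eP -scalemxAr -ysE.
  rewrite scaler_eq0 negb_or nze; apply: contraNneq (eigen_vec_neq0 l).
  by rewrite -wH => ->; rewrite mul0mx.
have nzE : eigen_mx l != 0 by have [] := eigen_mx_simple l.
apply: (mxsimple_image_rsim (cyclic_mx_module aG _) (eigen_mx_module l) HJ simS _ nzE).
apply/eqmxP/andP; split.
  by apply/row_subP => i; rewrite row_mul specht_sub ?row_sub.
apply: cyclic_mx_sub.
  apply/mxmoduleP => x Gx; rewrite -mulmxA -HJ // mulmxA submxMr //.
  by have [/mxmoduleP modS _ _] := simS; apply: modS.
by rewrite -wH submxMr // cyclic_mx_id.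
Qed.

Lemma eigen_projection_exists : exists P : young k -> endQD k, forall l,
  [/\ equivariant (P l), (P l <= eigen_mx l)%MS & eigen_mx l *m P l = eigen_mx l].
Proof.
exact: fin_all_exists (fun l => invariant_projection (eigen_mx_module l)).
Qed.

(** Orthogonality for the standard dot product: the symmetrizer producing [v] moves to the side of
    [u] as its transpose, which kills the component of the other shape. *)
Lemma eigen_mx_dot0 l m (u v : QD k) : l != m ->
  (u <= eigen_mx l)%MS -> (v <= eigen_mx m)%MS -> u *m v^T = 0.
Proof.
move=> nlm uE /cyclic_mx_sum[a ->]; rewrite linear_sum mulmx_sumr big1 // => x _.
rewrite linearZ -scalemxAr /= trmx_mul chord_repr_tr mulmxA.
have : (u *m rG x^-1%g <= eigen_mx l)%MS by rewrite mxmodule_trans ?inE ?eigen_mx_module.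
move: (u *m _) => u' u'E; have [b nzb eb] := eigen_vec_young_sym m.
rewrite -[eigen_vec m](scalerK nzb) -eb linearZ /= trmx_mul /young_sym trmx_mul.
rewrite row_sym_tr ?col_sym_tr; try exact: chord_repr_tr.
rewrite -scalemxAr mulmxA (cyclic_young_sym_ortho_tr _ u'E) ?mul0mx ?scaler0 //.
by rewrite (inj_eq young_double_inj).
Qed.

Section Projections.
Variable P : young k -> endQD k.
Hypothesis eqvP : forall l, equivariant (P l).
Hypothesis subP : forall l, (P l <= eigen_mx l)%MS.
Hypothesis fixP : forall l, eigen_mx l *m P l = eigen_mx l.

Lemma eigen_mx_proj_id d l (u : 'M_(d, _)) : (u <= eigen_mx l)%MS -> u *m P l = u.
Proof. by case/submxP => a ->; rewrite -mulmxA fixP. Qed.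

Lemma equivariant_young_sym l m : P m *m ysym l = ysym l *m P m.
Proof.
rewrite young_symE mulmx_sumr mulmx_suml; apply: eq_bigr => p _.
rewrite mulmx_sumr mulmx_suml; apply: eq_bigr => q _.
by rewrite -scalemxAr -scalemxAl eqvP.
Qed.

(** The image lies in [eigen_mx m], which the symmetrizer of [l] kills; as [P m] commutes with that
    symmetrizer, it also acts on the image by a nonzero scalar. *)
Lemma eigen_vec_proj0 l m : l != m -> eigen_vec l *m P m = 0.
Proof.
move=> nlm; have [a nza ea] := eigen_vec_young_sym l.
have sub : (eigen_vec l *m P m <= eigen_mx m)%MS by apply: mulmx_sub.
have /eqP : eigen_vec l *m P m *m ysym l = 0.
  by apply: (cyclic_young_sym_ortho _ sub); rewrite (inj_eq young_double_inj) eq_sym.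
have -> : eigen_vec l *m P m *m ysym l = a *: (eigen_vec l *m P m).
  by rewrite scalemxAl -ea -!(mulmxA (eigen_vec l)) equivariant_young_sym.
by rewrite scaler_eq0 (negPf nza) => /eqP.
Qed.

Lemma eigen_mx_proj0 d l m (u : 'M_(d, _)) : l != m ->
  (u <= eigen_mx l)%MS -> u *m P m = 0.
Proof.
move=> nlm uE; apply/row_matrixP => i; rewrite row_mul row0.
have /cyclic_mx_sum[a ->] := submx_trans (row_sub i u) uE.
rewrite mulmx_suml big1 // => x _.
by rewrite -scalemxAl -mulmxA eqvP mulmxA eigen_vec_proj0 // mul0mx scaler0.
Qed.

Lemma eigen_vec_sum (w : young k -> rat) m :
  eigen_vec m *m (\sum_l w l *: P l) = w m *: eigen_vec m.
Proof.
rewrite mulmx_sumr (bigD1 m) //= -scalemxAr eigen_mx_proj_id ?cyclic_mx_id //.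
by rewrite big1 ?addr0 // => l nlm; rewrite -scalemxAr eigen_vec_proj0 ?scaler0 1?eq_sym.
Qed.

(** Evaluating a combination of the projections at [eigen_vec m] isolates its coefficient [w m]; the
    projections are thus independent, and they span the commutant. *)
Lemma eigen_mx_span B : equivariant B -> exists w, B = \sum_l w l *: P l.
Proof.
apply: equivariant_span eqvP _ B => w w0 m.
have /eqP := eigen_vec_sum w m; rewrite w0 mulmx0 eq_sym scaler_eq0.
by rewrite (negPf (eigen_vec_neq0 m)) orbF => /eqP.
Qed.

Lemma eigen_mx_sum1 : \sum_l P l = 1%:M.
Proof.
have [w w1] : exists w, 1%:M = \sum_l w l *: P l.
  by apply: eigen_mx_span => s; rewrite mul1mx mulmx1.
rewrite w1; apply: eq_bigr => l _; rewrite (_ : w l = 1) ?scale1r //.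
have /eqP := eigen_vec_sum w l; rewrite -w1 mulmx1 -{1}[eigen_vec l]scale1r.
rewrite -subr_eq0 -scalerBl scaler_eq0 (negPf (eigen_vec_neq0 l)) orbF subr_eq0.
by move/eqP.
Qed.

Lemma eigen_mx_direct : mxdirect (\sum_l eigen_mx l)%MS.
Proof.
apply/mxdirect_sumsP => l _; apply/eqP; rewrite -submx0.
set U := (_ :&: _)%MS; rewrite -[U](@eigen_mx_proj_id _ l) ?capmxSl //.
have /sub_sumsmxP[u ->] : (U <= \sum_(m | m != l) eigen_mx m)%MS by apply: capmxSr.
rewrite mulmx_suml big1 ?sub0mx // => m nml.
by rewrite -mulmxA (@eigen_mx_proj0 _ m) ?mulmx0.
Qed.

Lemma eigen_mx_full : (\sum_l eigen_mx l :=: 1%:M)%MS.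
Proof.
apply/eqmxP; rewrite submx1 -eigen_mx_sum1 /=; apply: summx_sub => l _.
by apply: submx_trans (subP l) _; apply: (sumsmx_sup l).
Qed.

End Projections.

Lemma equivariant_intersection g : equivariant (intersection_mx g k).
Proof.
move=> s; apply/row_matrixP => i; rewrite !row_mul.
rewrite -[i]enum_valK; set C := enum_val i.
have -> : row (enum_rank C) (rG s) = chord_vec C *m rG s by rewrite rowE.
have -> : row (enum_rank C) (intersection_mx g k) = chord_vec C *m intersection_mx g k.
  by rewrite rowE.
rewrite chord_vec_repr; apply/rowP => j; rewrite -[j]enum_valK.
rewrite chord_repr_coord !chord_vec_mul !mxE !enum_rankK /pairing.
by rewrite -(union_components_act C _ s) chord_diagram_actKV.
Qed.

Lemma intersection_tr g : (intersection_mx g k)^T = intersection_mx g k.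
Proof. by apply/matrixP => i j; rewrite !mxE /pairing union_componentsC. Qed.

Lemma eigen_mx_eigen g l (u : QD k) : (0 < g)%N -> (u <= eigen_mx l)%MS ->
  u *m intersection_mx g k = chord_eigenvalue g l *: u.
Proof.
move=> g0 uE; have [P PP] := eigen_projection_exists.
have eqvP m : equivariant (P m) by have [] := PP m.
have subP m : (P m <= eigen_mx m)%MS by have [] := PP m.
have fixP m : eigen_mx m *m P m = eigen_mx m by have [] := PP m.
have [w Mw] := eigen_mx_span eqvP subP fixP (@equivariant_intersection g).
have Mv : eigen_vec l *m intersection_mx g k = w l *: eigen_vec l.
  by rewrite Mw (eigen_vec_sum eqvP).
(* The scalar is read off from the generator, a common Jucys-Murphy eigenvector whose coefficient at
   [C0] is nonzero. *)
have -> : chord_eigenvalue g l = w l.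
  rewrite chord_eigenvalueE; symmetry.
  apply: (intersection_eigenvalue g0 _ (eigen_vec_entry_neq0 l) Mv) => j.
  by rewrite -mulmxA young_sym_jucys_murphy -scalemxAr.
rewrite Mw mulmx_sumr (bigD1 l) //= -scalemxAr (eigen_mx_proj_id fixP uE).
rewrite big1 ?addr0 // => m nml.
by rewrite -scalemxAr (eigen_mx_proj0 eqvP subP _ uE) ?scaler0 1?eq_sym.
Qed.

(** Splitting [x] along the components, which are orthogonal for the dot product, turns the form
    into a sum of squared lengths weighted by the nonnegative eigenvalues. *)
Lemma intersection_possemidef g : (0 < g)%N -> possemidef_mx (intersection_mx g k).
Proof.
move=> g0; split=> [|x]; first exact: intersection_tr.
have [P PP] := eigen_projection_exists.
have eqvP m : equivariant (P m) by have [] := PP m.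
have subP m : (P m <= eigen_mx m)%MS by have [] := PP m.
have fixP m : eigen_mx m *m P m = eigen_mx m by have [] := PP m.
have xE : x = \sum_l x *m P l.
  by rewrite -mulmx_sumr (eigen_mx_sum1 eqvP subP fixP) mulmx1.
have xPl l : (x *m P l <= eigen_mx l)%MS by apply: mulmx_sub.
have -> : x *m intersection_mx g k *m x^T =
    \sum_l chord_eigenvalue g l *: (x *m P l *m (x *m P l)^T).
  rewrite {1}xE mulmx_suml mulmx_suml; apply: eq_bigr => l _.
  rewrite (eigen_mx_eigen g0 (xPl l)) -scalemxAl; congr (_ *: _).
  rewrite {2}xE linear_sum mulmx_sumr (bigD1 l) //= big1 ?addr0 // => m nml.
  by rewrite (@eigen_mx_dot0 l m) // eq_sym.
rewrite summxE; apply: sumr_ge0 => l _; rewrite mxE mulr_ge0 ?chord_eigenvalue_ge0 //.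
by rewrite mxE sumr_ge0 // => i _; rewrite !mxE -expr2 sqr_ge0.
Qed.

End Decomposition.

Theorem theorem1p4 (k : nat) (k_gt0 : (0 < k)%N) :
  (forall g : nat, (0 < g)%N -> possemidef_mx (intersection_mx g k)) /\
  exists E : young k -> endQD k,
    [/\ mxdirect (\sum_(l : young k) E l)%MS,
        (\sum_(l : young k) E l :=: 1%:M)%MS,
        forall g : nat, (0 < g)%N ->
          (forall (l m : young k) (u v : QD k),
             l != m -> (u <= E l)%MS -> (v <= E m)%MS ->
             intersection_form g u v = 0) /\
          (forall (l : young k) (u : QD k),
             (u <= E l)%MS ->
             u *m intersection_mx g k = chord_eigenvalue g l *: u)
      & forall l : young k,
          mxsimple (chord_repr k) (E l) /\
          exists El_mod : mxmodule (chord_repr k) (E l),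
            mx_rsim (submod_repr El_mod) (specht_repr (young_double l))].
Proof.
split; first exact: intersection_possemidef.
have [P PP] := eigen_projection_exists k.
have eqvP m : equivariant (P m) by have [] := PP m.
have subP m : (P m <= eigen_mx m)%MS by have [] := PP m.
have fixP m : eigen_mx m *m P m = eigen_mx m by have [] := PP m.
exists (@eigen_mx k); split.
- exact: eigen_mx_direct eqvP subP fixP.
- exact: eigen_mx_full eqvP subP fixP.
- move=> g g0; split=> [l m u v nlm uE vE|l u]; last exact: eigen_mx_eigen.
  (* The matrix only rescales [u], so orthogonality for the form follows from that for the dot
     product. *)
  by rewrite /intersection_form (eigen_mx_eigen g0 uE) -scalemxAl
    (eigen_mx_dot0 nlm uE vE) scaler0 mxE.
- move=> l; split; first exact: eigen_mx_simple.
  by exists (eigen_mx_module l); apply: eigen_mx_specht.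
Qed.
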